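(* Let $\mathbf X$ be a finite dimensional Hilbert space, $\psi:\mathbf X\to\mathbf X$ a differentiable mapping and $f:\mathbf X\to[-\infty,\infty]$ a proper function. Let $G(x)=\psi(x)+\partial f(x)$ and $S(y)=G^{-1}(y)=\{x\in\mathbf X\mid y\in\psi(x)+\partial f(x)\}$. Assume that $\bar x$ satisfies $0\in\psi(\bar x)+\partial f(\bar x)$, that $\psi$ is strictly differentiable at $\bar x$, and that $f$ is both prox-regular and subdifferentially continuous at $\bar x$ for $\bar v:=-\psi(\bar x)$. Then the following properties are equivalent: (a) the mapping $G$ is metrically regular at $\bar x$ for $0$ and $\partial f$ is strictly proto-differentiable at $\bar x$ for $\bar v$; (b) the solution mapping $S$ has a Lipschitz continuous single-valued localization $s$ around $0\in\mathbf X$ for $\bar x$, which is strictly differentiable at $0$. Moreover, if (a) holds, then the derivative of $s$ at $0$ is given by $$\nabla s(0)=\big(P_{\overline K}\circ(\nabla\psi(\bar x)+A)|_{\overline K}\big)^{-1}\circ P_{\overline K},$$ where $\overline K:=\mathrm{dom}\,\mathrm d^2f(\bar x,\bar v)$ (a linear subspace), $A:\mathbf X\to\mathbf X$ is a linear symmetric mapping with $D(\partial f)(\bar x,\bar v)(w)=A(w)+N_{\overline K}(w)$ for all $w\in\mathbf X$, $P_{\overline K}$ is the projection mapping onto $\overline K$, and $(\nabla\psi(\bar x)+A)|_{\overline K}$ is the restriction of $\nabla\psi(\bar x)+A$ to $\overline K$.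
   Context: Set limits are in the Painlevé–Kuratowski sense. For a set $\Omega$ and $x\in\Omega$: $T_\Omega(x)=\limsup_{t\searrow0}\frac{\Omega-x}{t}$ (tangent cone), $\widehat T_\Omega(x)=\liminf_{x'\to x,\,x'\in\Omega,\,t\searrow0}\frac{\Omega-x'}{t}$ (regular tangent cone), $\widetilde T_\Omega(x)=\limsup_{x'\to x,\,x'\in\Omega,\,t\searrow0}\frac{\Omega-x'}{t}$ (paratingent cone). The regular normal cone is the polar $\widehat N_\Omega(x)=T_\Omega(x)^*$; the limiting normal cone $N_\Omega(\bar x)$ consists of limits of $v^k\in\widehat N_\Omega(x^k)$ with $x^k\to\bar x$, $x^k\in\Omega$. For a linear subspace $\overline K$, $N_{\overline K}(w)=\overline K^\perp$ if $w\in\overline K$ and $\emptyset$ otherwise. For $f$ with $f(\bar x)$ finite, $\partial f(\bar x)=\{v\mid(v,-1)\in N_{\mathrm{epi}f}(\bar x,f(\bar x))\}$. $f$ is prox-regular at $\bar x$ for $\bar v$ if $f$ is finite at $\bar x$, locally lower semicontinuous around $\bar x$, $\bar v\in\partial f(\bar x)$, and there exist $\varepsilon>0$, $r\ge0$ such that $f(x')\ge f(x)+\langle v,x'-x\rangle-\frac r2\|x'-x\|^2$ for all $x'$ with $\|x'-\bar x\|\le\varepsilon$ whenever $v\in\partial f(x)$, $\|(x,v)-(\bar x,\bar v)\|\le\varepsilon$ and $f(x)<f(\bar x)+\varepsilon$. $f$ is subdifferentially continuous at $\bar x$ for $\bar v$ if $(x^k,v^k)\to(\bar x,\bar v)$ with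 $v^k\in\partial f(x^k)$ implies $f(x^k)\to f(\bar x)$. The second subderivative is $\mathrm d^2f(\bar x,\bar v)(w)=\liminf_{t\searrow0,\,w'\to w}\frac{f(\bar x+tw')-f(\bar x)-t\langle\bar v,w'\rangle}{\frac12t^2}$, with domain the set where it is $<\infty$. For a set-valued mapping $F$ and $(x,y)\in\mathrm{gph}\,F$: $\eta\in DF(x,y)(w)\iff(w,\eta)\in T_{\mathrm{gph}F}(x,y)$; $F$ is strictly proto-differentiable at $x$ for $y$ if $\widehat T_{\mathrm{gph}F}(x,y)=\widetilde T_{\mathrm{gph}F}(x,y)$. Under strict proto-differentiability of $\partial f$ at $\bar x$ for $\bar v$ (with $f$ prox-regular and subdifferentially continuous there) $\overline K$ is a linear subspace and a mapping $A$ as in the claim exists. $F$ is metrically regular at $\bar x$ for $\bar y\in F(\bar x)$ if there exist $\kappa>0$ and neighborhoods $U$ of $\bar x$, $V$ of $\bar y$ with $\mathrm{dist}(x,F^{-1}(y))\le\kappa\,\mathrm{dist}(y,F(x))$ for all $(x,y)\in U\times V$. $S$ has a Lipschitz continuous single-valued localization around $0$ for $\bar x$ if there are neighborhoods $U$ of $\bar x$ and $V$ of $0$ such that $y\mapsto s(y):=S(y)\cap U$ is single-valued and Lipschitz continuous on $V$. *)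

(* Defs.v *)
From HB Require Import structures.
From mathcomp Require Export all_boot all_order all_algebra.
From mathcomp Require Export sesquilinear.
From mathcomp Require Export all_classical all_reals all_analysis.
Export Order.TTheory GRing.Theory Num.Theory.
Export numFieldNormedType.Exports.

Set Implicit Arguments.
Unset Strict Implicit.
Unset Printing Implicit Defensive.

Local Open Scope classical_set_scope.
Local Open Scope ring_scope.

(* A finite dimensional Hilbert space is a [normedModType R] [X] that is
   [finite_dimensional], together with a dot product [dot : {dot X for idfun}]
   which [induces_norm]. *)
Definition finite_dimensional (R : realType) (X : lmodType R) : Prop :=
  exists (n : nat) (e : 'I_n -> X),
    forall x, exists c : 'I_n -> R, x = \sum_(i < n) c i *: e i.

Definition induces_norm (R : realType) (X : normedModType R)
    (dot : X -> X -> R) : Prop :=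
  forall x, `|x| ^+ 2 = dot x x.

(* The norm of the library on [X * R^o] and [X * X] is the maximum norm: it is
   used for the topology only. Polarity in [X * R^o] refers to the product dot
   product below. *)
Definition dot_epi (R : realType) (X : lmodType R) (dot : X -> X -> R)
    (p q : X * R^o) : R :=
  dot p.1 q.1 + (p.2 : R) * (q.2 : R).

(* Painleve-Kuratowski limits of the family [C] along the filter [F]. *)
Definition outer_limit (T : Type) (E : topologicalType) (F : set_system T)
    (C : T -> set E) : set E :=
  [set u | forall V, nbhs u V ->
     forall P, F P -> exists2 t, P t & C t `&` V !=set0].

Definition inner_limit (T : Type) (E : topologicalType) (F : set_system T)
    (C : T -> set E) : set E :=
  [set u | forall V, nbhs u V -> F [set t | C t `&` V !=set0]].

Section Cones.
Context (R : realType) (E : normedModType R).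
Implicit Types (Omega : set E) (x v w : E) (dot : E -> E -> R).

Definition diff_quotient_set Omega x (t : R) : set E :=
  [set t^-1 *: (y - x) | y in Omega].

Definition tangent_cone Omega x : set E :=
  outer_limit (0 : R)^'+ (diff_quotient_set Omega x).

Definition regular_tangent_cone Omega x : set E :=
  inner_limit (filter_prod (within Omega (nbhs x)) (0 : R)^'+)
    (fun p => diff_quotient_set Omega p.1 p.2).

Definition paratingent_cone Omega x : set E :=
  outer_limit (filter_prod (within Omega (nbhs x)) (0 : R)^'+)
    (fun p => diff_quotient_set Omega p.1 p.2).

Definition polar dot (C : set E) : set E :=
  [set v | forall w, C w -> dot v w <= 0].

Definition regular_normal_cone dot Omega x : set E :=
  [set v | Omega x /\ polar dot (tangent_cone Omega x) v].

Definition limiting_normal_cone dot Omega x : set E :=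
  [set v | Omega x /\ exists xk vk : nat -> E,
     [/\ forall k, Omega (xk k),
         forall k, regular_normal_cone dot Omega (xk k) (vk k),
         xk @ \oo --> x & vk @ \oo --> v]].

End Cones.

Section SetValued.
Context (R : realType) (X Y : normedModType R).
Implicit Types (F : X -> set Y) (x : X) (y : Y).

Definition graph_of F : set (X * Y) := [set p | F p.1 p.2].

Definition inverse_map F (y : Y) : set X := [set x | F x y].

Definition graphical_derivative F x y (w : X) : set Y :=
  [set eta | tangent_cone (graph_of F) (x, y) (w, eta)].

Definition strictly_proto_differentiable F x y : Prop :=
  regular_tangent_cone (graph_of F) (x, y) =
  paratingent_cone (graph_of F) (x, y).

Definition dist_to (E : normedModType R) (z : E) (C : set E) : \bar R :=
  ereal_inf [set `|z - u|%:E | u in C].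

Definition metrically_regular F (xbar : X) (ybar : Y) : Prop :=
  exists (kappa : R) (U : set X) (V : set Y),
    [/\ 0 < kappa, nbhs xbar U, nbhs ybar V &
        forall x y, U x -> V y ->
          (dist_to x (inverse_map F y) <= kappa%:E * dist_to y (F x))%E].

(* [s] is only relevant on the neighborhood [V]. *)
Definition lipschitz_localization (S : Y -> set X) (ybar : Y) (xbar : X)
    (s : Y -> X) : Prop :=
  exists (U : set X) (V : set Y),
    [/\ nbhs xbar U, nbhs ybar V,
        forall y, V y -> S y `&` U = [set s y] &
        exists k : R, k.-lipschitz_V s].

Definition strictly_differentiable (g : X -> Y) (x : X) : Prop :=
  differentiable g x /\
  (fun p : X * X =>
     `|p.1 - p.2|^-1 *: (g p.1 - g p.2 - 'd g x (p.1 - p.2)))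
    @ (within [set p | p.1 != p.2] (nbhs (x, x))) --> (0 : Y).

End SetValued.

Section Subdifferential.
Context (R : realType) (X : normedModType R).
Implicit Types (dot : X -> X -> R) (f : X -> \bar R) (x v w : X).

Definition proper_fun f : Prop :=
  (forall x, (-oo < f x)%E) /\ exists x, (f x < +oo)%E.

Definition epigraph f : set (X * R^o) := [set p | (f p.1 <= (p.2 : R)%:E)%E].

Definition subdifferential dot f x : set X :=
  [set v | f x \is a fin_num /\
     limiting_normal_cone (dot_epi dot) (epigraph f)
       ((x, fine (f x)) : X * R^o) ((v, -1) : X * R^o)].

(* Local lower semicontinuity in the sense of Rockafellar and Wets; it is
   implied by lower semicontinuity at all points of a neighborhood. *)
Definition locally_lsc f x : Prop :=
  exists2 eps : R, 0 < eps &
    forall alpha : R, (alpha%:E <= f x + eps%:E)%E ->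
      closed [set y | `|y - x| <= eps /\ (f y <= alpha%:E)%E].

Definition prox_regular dot f (xbar vbar : X) : Prop :=
  [/\ f xbar \is a fin_num, locally_lsc f xbar,
      subdifferential dot f xbar vbar &
      exists eps r : R, [/\ 0 < eps, 0 <= r &
        forall x v, subdifferential dot f x v ->
          Num.sqrt (`|x - xbar| ^+ 2 + `|v - vbar| ^+ 2) <= eps ->
          (f x < f xbar + eps%:E)%E ->
          forall x', `|x' - xbar| <= eps ->
            (f x + (dot v (x' - x) - r / 2 * `|x' - x| ^+ 2)%:E <= f x')%E]].

Definition subdifferentially_continuous dot f (xbar vbar : X) : Prop :=
  forall xk vk : nat -> X,
    (forall k, subdifferential dot f (xk k) (vk k)) ->
    xk @ \oo --> xbar -> vk @ \oo --> vbar ->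
    f \o xk @ \oo --> f xbar.

Definition second_difference_quotient dot f (xbar vbar : X) (p : R * X)
    : \bar R :=
  ((2^-1 * p.1 ^+ 2)^-1%:E *
   (f (xbar + p.1 *: p.2)%R - f xbar - (p.1 * dot vbar p.2)%:E))%E.

Definition second_subderivative dot f (xbar vbar w : X) : \bar R :=
  limf_einf (second_difference_quotient dot f xbar vbar)
    (filter_prod (0 : R)^'+ (nbhs w)).

Definition dom_second_subderivative dot f (xbar vbar : X) : set X :=
  [set w | (second_subderivative dot f xbar vbar w < +oo)%E].

Definition linear_subspace (K : set X) : Prop :=
  K 0 /\ forall (a : R) u v, K u -> K v -> K (a *: u + v).

(* Nearest point of [K], with the dummy value 0 if there is none. *)
Definition projection (K : set X) (x : X) : X :=
  xget 0 [set p | K p /\ forall q, K q -> `|x - p| <= `|x - q|].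

Definition symmetric_map dot (A : X -> X) : Prop :=
  forall u v, dot (A u) v = dot u (A v).

Definition graphical_derivative_form dot f (xbar vbar : X) (K : set X)
    (A : X -> X) : Prop :=
  forall w, graphical_derivative (subdifferential dot f) xbar vbar w =
    [set A w + z | z in limiting_normal_cone dot K w].

End Subdifferential.

(* Main.v *)
From HB Require Import structures.
Require Import Defs.
From mathcomp Require Import ring lra.

(** Write [L] for the derivative of [psi] at [xbar], [vbar] for [- psi xbar] and
    [W] for the paratingent cone of the graph of the subdifferential at
    [(xbar, vbar)].

    From the localization to metric regularity. If [s] is a strictly
    differentiable localization with derivative [H], then near [(xbar, vbar)]
    the graph of the subdifferential is parametrized by
    [y |-> (s y, y - psi (s y))], with inverse [(x, v) |-> v + psi x]. Both maps
    are strictly differentiable, so the paratingent and the regular tangent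
    cone are the same subspace [w = H (v + L w)]
    ([paratingent_section], [section_regular_tangent]). Metric regularity
    follows from the Lipschitz bound on [s].

    From metric regularity to the localization. Strict proto-differentiability
    makes [W] a linear subspace: the regular tangent cone can be added to the
    paratingent cone, which is symmetric. The subgradient inequality of
    prox-regularity makes [W] hypomonotone, so that [v + rho *: w] is injective
    on [W] for large [rho] and [W] has at most the dimension of [X]. Metric
    regularity makes [v + L w] surjective on [W], by taking limits of difference
    quotients of solutions. Hence [W] is the graph [w = H (v + L w)] of a linear
    [H] ([graph_of_hypomonotone_subspace]), and by compactness of the unit
    sphere ([strict_approximation]) two nearby solutions satisfy
    [x' - x = H (y' - y)] up to a small relative error. So there is at most one
    nearby solution for each [y], metric regularity provides one, and it
    is Lipschitz continuous and strictly differentiable with derivative [H]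
    ([metric_regularity_localization]).

    The second-order objects. Put [M y = y - L (H y)]. Summing subgradient
    inequalities along closed polygons of curves [t |-> s (t *: y)] with ever
    shorter steps shows that [dot (M a) (H b)] is symmetric, that is, [W] is
    Lagrangian ([curves_lagrangian]). The same inequalities show that the
    domain [K] of the second subderivative contains the range of [H] and is
    orthogonal to [M y] whenever [H y = 0]
    ([range_sub_dom], [dom_orth_kernel]). In a Lagrangian subspace these two
    facts leave only [K = range H], and [W] consists of the pairs [(w, v)] with
    [w] in [K] and [v - A w] orthogonal to [K], for a symmetric [A]
    ([symmetric_part_exists]). For [w = H y] the pair
    [(w, y - L w)] lies in [W], so [y] and [L w + A w] have the same projection
    onto [K]; this is the formula for the derivative of [s]. *)

Set Implicit Arguments.
Unset Strict Implicit.
Unset Printing Implicit Defensive.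

Local Open Scope classical_set_scope.
Local Open Scope ring_scope.

(** * Orthogonality and compactness in finite dimension *)

Section DotProduct.
Context (R : realType) (X : normedModType R) (dot : {dot X for (@idfun R)}).
Implicit Types (x y z u v : X) (a : R).

Lemma dotDl x y z : dot (x + y) z = dot x z + dot y z.
Proof. exact: linearDl. Qed.
Lemma dotDr x y z : dot z (x + y) = dot z x + dot z y.
Proof. exact: linearDr. Qed.
Lemma dotNl x z : dot (- x) z = - dot x z.
Proof. exact: linearNl. Qed.
Lemma dotNr x z : dot z (- x) = - dot z x.
Proof. exact: linearNr. Qed.
Lemma dotBl x y z : dot (x - y) z = dot x z - dot y z.
Proof. exact: linearBl. Qed.
Lemma dotBr x y z : dot z (x - y) = dot z x - dot z y.
Proof. exact: linearBr. Qed.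
Lemma dotZl a x z : dot (a *: x) z = a * dot x z.
Proof. exact: linearZl_LR. Qed.
Lemma dotZr a x z : dot z (a *: x) = a * dot z x.
Proof. exact: (linearZr_LR dot z a x). Qed.
Lemma dot0l z : dot 0 z = 0.
Proof. exact: linear0l. Qed.
Lemma dot0r z : dot z 0 = 0.
Proof. exact: linear0r. Qed.
Lemma dotC x y : dot x y = dot y x.
Proof. by rewrite (@hermitian_subproof _ _ _ _ dot) expr0 mul1r. Qed.
Lemma dot_suml (I : finType) (F : I -> X) z :
  dot (\sum_i F i) z = \sum_i dot (F i) z.
Proof. exact: linear_sumlz. Qed.

End DotProduct.
Arguments dotC {R X} dot x y.

Section LinearSubspaces.
Context (R : realType) (X : normedModType R).
Implicit Types (K : set X).

Lemma subspace0 K : linear_subspace K -> K 0.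
Proof. by case. Qed.
Lemma subspaceZ K a x : linear_subspace K -> K x -> K (a *: x).
Proof. by move=> [K0 KP] Kx; rewrite -[_ *: _]addr0; exact: KP. Qed.
Lemma subspaceD K x y : linear_subspace K -> K x -> K y -> K (x + y).
Proof. by move=> [K0 KP] Kx Ky; rewrite -[x]scale1r; exact: KP. Qed.
Lemma subspaceB K x y : linear_subspace K -> K x -> K y -> K (x - y).
Proof.
by move=> sK Kx Ky; rewrite -scaleN1r; apply: subspaceD => //; exact: subspaceZ.
Qed.
Lemma subspace_sum K (I : finType) (F : I -> X) :
  linear_subspace K -> (forall i, K (F i)) -> K (\sum_i F i).
Proof.
move=> sK KF; apply: (big_ind K) => [|x y|i _] //; first exact: subspace0.
exact: subspaceD.
Qed.

End LinearSubspaces.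

Section EuclideanSpace.
Context (R : realType) (X : normedModType R) (dot : {dot X for (@idfun R)}).
Hypotheses (hfin : finite_dimensional X) (hdot : induces_norm dot).
Implicit Types (x y z u v : X) (a : R) (K : set X).

Lemma dot_eq0 x : dot x x = 0 -> x = 0.
Proof.
by rewrite -hdot => /eqP; rewrite sqrf_eq0 normr_eq0 => /eqP.
Qed.

(** Gram-Schmidt, with one more spanning vector at each step: a subspace either
    already lies in the span of the first vectors, or it has one new direction
    up to that span. *)
Lemma orthonormal_basis_of_span (n : nat) (e : 'I_n -> X) K :
  linear_subspace K ->
  (forall x, K x -> exists c : 'I_n -> R, x = \sum_i c i *: e i) ->
  exists m (b : 'I_m -> X), [/\ forall i, K (b i),
    forall i j, dot (b i) (b j) = (i == j)%:R &
    forall x, K x -> x = \sum_i dot x (b i) *: b i].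
Proof.
elim: n e K => [|n IHn] e K sK spanK.
  exists 0%N, (fun=> 0); split => [[]|[]|x /spanK[c ->]] //.
  by rewrite !big_ord0.
pose K0 := [set x | K x /\ exists c : 'I_n -> R,
                      x = \sum_i c i *: e (lift ord0 i)].
have sK0 : linear_subspace K0.
  split=> [|a x y [Kx [c xE]] [Ky [d yE]]].
    split; first exact: subspace0.
    by exists (fun=> 0); rewrite big1 // => i _; rewrite scale0r.
  split; first by apply: subspaceD => //; exact: subspaceZ.
  exists (fun i => a * c i + d i); rewrite xE yE scaler_sumr -big_split.
  by apply: eq_bigr => i _ /=; rewrite scalerA scalerDl.
have [|m [b [Kb ob bP]]] := IHn (fun i => e (lift ord0 i)) K0 sK0.
  by move=> x [].
have [KK0|/existsNP[x /not_implyP[Kx nK0x]]] := pselect (forall x, K x -> K0 x).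
  exists m, b; split => [i|//|x /KK0]; [by have [] := Kb i | exact: bP].
have [c xE] := spanK x Kx.
have c0 : c ord0 != 0.
  apply: contra_notN nK0x => /eqP c0; split => //.
  exists (fun i => c (lift ord0 i)); rewrite xE big_ord_recl c0 scale0r add0r.
  by [].
pose u0 := x - \sum_i dot x (b i) *: b i.
have K0s y : K0 (\sum_i dot y (b i) *: b i).
  by apply: subspace_sum => // i; exact: subspaceZ.
have Ku0 : K u0 by apply: subspaceB => //; have [] := K0s x.
have u0_neq0 : u0 != 0.
  by apply: contra_notN nK0x; rewrite subr_eq0 => /eqP ->; exact: K0s.
have du0 i : dot u0 (b i) = 0.
  rewrite dotBl dot_suml (bigD1 i) //= dotZl ob eqxx mulr1 big1 ?addr0 ?subrr//.
  by move=> j /negPf ji; rewrite dotZl ob ji mulr0.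
pose u := `|u0|^-1 *: u0.
have nu0 : `|u0| != 0 by rewrite normr_eq0.
have duu : dot u u = 1.
  by rewrite dotZl dotZr -hdot expr2 mulKf // mulVf.
have dub i : dot u (b i) = 0 by rewrite dotZl du0 mulr0.
pose b' (i : 'I_m.+1) := if unlift ord0 i is Some j then b j else u.
exists m.+1, b'; split.
- move=> i; rewrite /b'; case: unliftP => [j _|_]; first by have [] := Kb j.
  exact: subspaceZ.
- move=> i j; rewrite /b'; case: unliftP => [i' ->|->];
  case: unliftP => [j' ->|->] //.
  by rewrite (dotC dot) dub.
- move=> y Ky; rewrite big_ord_recl /b' unlift_none.
  under eq_bigr do rewrite liftK.
  have [d yE] := spanK y Ky.
  pose t := d ord0 / c ord0.
  have K0y : K0 (y - t *: x).
    split; first by apply: subspaceB => //; exact: subspaceZ.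
    exists (fun i => d (lift ord0 i) - t * c (lift ord0 i)).
    rewrite yE xE !big_ord_recl scalerDr scalerA /t divfK // opprD.
    rewrite addrACA subrr add0r.
    rewrite scaler_sumr -sumrB; apply: eq_bigr => i _.
    by rewrite scalerA scalerBl.
  have K0z : K0 (y - (t * `|u0|) *: u).
    rewrite /u scalerA mulfK // /u0 scalerBr opprB addrA addrAC.
    by apply: subspaceD => //; exact: subspaceZ.
  have zE := bP _ K0z.
  have dyu : dot y u = t * `|u0|.
    have : dot (y - (t * `|u0|) *: u) u = 0.
      rewrite zE dot_suml big1 // => i _.
      by rewrite dotZl [dot (b i) u](dotC dot) dub mulr0.
    by rewrite dotBl dotZl duu mulr1 => /eqP; rewrite subr_eq0 => /eqP.
  rewrite dyu; apply/eqP; rewrite addrC -subr_eq {1}zE; apply/eqP.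
  by apply: eq_bigr => i _; rewrite dotBl dotZl dub mulr0 subr0.
Qed.

Lemma orthonormal_basis : exists m (b : 'I_m -> X),
  (forall i j, dot (b i) (b j) = (i == j)%:R) /\
  forall x, x = \sum_i dot x (b i) *: b i.
Proof.
have [n [e spanX]] := hfin.
have [||m [b [_ ob bP]]] := @orthonormal_basis_of_span n e setT.
- by [].
- by move=> x _; exact: spanX.
- by exists m, b; split => // x; exact: bP.
Qed.

(** By Pythagoras a foot of the perpendicular is the only nearest point, so
    that [projection] returns it rather than the dummy value. *)
Lemma projection_eq K x p : linear_subspace K -> K p ->
  (forall q, K q -> dot (x - p) q = 0) -> projection K x = p.
Proof.
move=> sK Kp orth.
have pyth q : K q -> `|x - q| ^+ 2 = `|x - p| ^+ 2 + `|p - q| ^+ 2.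
  move=> Kq; have -> : x - q = (x - p) + (p - q) by rewrite addrA subrK.
  have : dot (x - p) (p - q) = 0 by apply: orth; exact: subspaceB.
  rewrite !hdot; move: (x - p) (p - q) => u v uv.
  by rewrite dotDl !dotDr (dotC dot v) uv addr0 add0r.
apply: xget_unique => [|p' [Kp' min]].
  split => // q Kq; rewrite -(@ler_pXn2r _ 2) ?nnegrE // (pyth q) //.
  by rewrite lerDl sqr_ge0.
have := min p Kp; rewrite -(@ler_pXn2r _ 2) ?nnegrE // (pyth p') //.
rewrite gerDl => le0; apply/esym/eqP; rewrite -subr_eq0 -normr_eq0 -sqrf_eq0.
by rewrite eq_le le0 sqr_ge0.
Qed.

Lemma projection_orth K : linear_subspace K ->
  forall x, K (projection K x) /\
    forall q, K q -> dot (x - projection K x) q = 0.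
Proof.
move=> sK x; have [n [e spanX]] := hfin.
have [|m [b [Kb ob bP]]] := @orthonormal_basis_of_span n e K sK.
  by move=> y _; exact: spanX.
pose p := \sum_i dot x (b i) *: b i.
have Kp : K p by apply: subspace_sum => // i; exact: subspaceZ.
have orth q : K q -> dot (x - p) q = 0.
  move=> /bP ->; rewrite (dotC dot) dot_suml big1 // => i _.
  rewrite dotZl (dotC dot (b i)) dotBl dot_suml (bigD1 i) //= dotZl ob eqxx mulr1.
  rewrite big1 ?addr0 ?subrr ?mulr0 // => j /negPf ji.
  by rewrite dotZl ob ji mulr0.
by rewrite (projection_eq sK Kp orth).
Qed.

Lemma projection_linear K : linear_subspace K -> linear (projection K).
Proof.
move=> sK a x y; have [Kx ox] := projection_orth sK x.
have [Ky oy] := projection_orth sK y.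
apply: projection_eq => // [|q Kq].
  by apply: subspaceD => //; exact: subspaceZ.
rewrite opprD addrACA -scalerBr dotDl dotZl ox // oy //.
by rewrite mulr0 addr0.
Qed.

Lemma projection_sym K x y : linear_subspace K ->
  dot (projection K x) y = dot x (projection K y).
Proof.
move=> sK; have [Kx ox] := projection_orth sK x.
have [Ky oy] := projection_orth sK y.
have e1 : dot x (projection K y) = dot (projection K x) (projection K y).
  by apply/eqP; rewrite -subr_eq0 -dotBl ox.
have e2 : dot (projection K x) y = dot (projection K x) (projection K y).
  by apply/eqP; rewrite -subr_eq0 -dotBr (dotC dot) oy.
by rewrite e1 e2.
Qed.

Lemma continuous_sum (T : topologicalType) (I : finType) (Y : normedModType R)
    (F : I -> T -> Y) :
  (forall i, continuous (F i)) -> continuous (fun t => \sum_i F i t).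
Proof.
move=> cF; rewrite -fct_sumE; apply: (big_ind (fun g : T -> Y => continuous g)).
- by move=> t; exact: cvg_cst.
- by move=> g h cg ch t; apply: cvgD; [exact: cg | exact: ch].
- by move=> i _; exact: cF.
Qed.

(** Through polarization the dot product inherits continuity from the norm. *)
Lemma dotE x y : dot x y = 4^-1 * (`|x + y| ^+ 2 - `|x - y| ^+ 2).
Proof.
rewrite !hdot !dotDl !dotDr !dotNl !dotNr [dot y x](dotC dot); lra.
Qed.

Lemma cvg_dot (T : Type) (F : set_system T) (FF : Filter F) (f g : T -> X) x y :
  f @ F --> x -> g @ F --> y -> (fun t => dot (f t) (g t)) @ F --> dot x y.
Proof.
move=> fx gy; under eq_fun do rewrite dotE; rewrite dotE.
apply: cvgMr; apply: cvgB.
- rewrite expr2; under eq_fun do rewrite expr2.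
  by apply: cvgM; apply: cvg_norm; exact: cvgD.
- rewrite expr2; under eq_fun do rewrite expr2.
  by apply: cvgM; apply: cvg_norm; exact: cvgB.
Qed.

Lemma finite_dim_linear_continuous (Y : normedModType R)
    (H : {linear X -> Y}) : continuous H.
Proof.
have [m [b [ob bP]]] := orthonormal_basis.
have -> : (H : X -> Y) = (fun x => \sum_i dot x (b i) *: H (b i)).
  apply/funext => x; rewrite {1}(bP x) linear_sum.
  by apply: eq_bigr => i _; rewrite linearZ.
apply: continuous_sum => i x; apply: cvgZr_tmp.
by apply: cvg_dot; [exact: cvg_id | exact: cvg_cst].
Qed.

(** In an orthonormal basis [H] is a square matrix with trivial kernel. *)
Lemma linear_inj_surj (H : {linear X -> X}) :
  (forall x, H x = 0 -> x = 0) -> forall y, exists x, H x = y.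
Proof.
have [m [b [ob bP]]] := orthonormal_basis => Hinj y.
pose A : 'M[R]_m := \matrix_(i, j) dot (H (b i)) (b j).
pose comb (v : 'rV[R]_m) : X := \sum_i v 0 i *: b i.
have HA (v : 'rV[R]_m) : H (comb v) = comb (v *m A).
  rewrite linear_sum [LHS]bP; apply: eq_bigr => j _; congr (_ *: _).
  rewrite dot_suml mxE; apply: eq_bigr => i _.
  by rewrite linearZ dotZl mxE.
have comb0 (v : 'rV[R]_m) : comb v = 0 -> v = 0.
  move=> c0; apply/rowP => j; rewrite mxE -(dot0l dot (b j)) -c0 dot_suml.
  rewrite (bigD1 j) //= dotZl ob eqxx mulr1 big1 ?addr0 // => i /negPf ij.
  by rewrite dotZl ob ij mulr0.
have : row_free A.
  apply: inj_row_free => v vA; apply/comb0/Hinj.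
  by rewrite HA vA /comb big1 // => i _; rewrite mxE scale0r.
rewrite row_free_unit => uA.
exists (comb ((\row_i dot y (b i)) *m invmx A)).
rewrite HA mulmxKV // [RHS]bP; apply: eq_bigr => i _.
by rewrite mxE.
Qed.

(** In an orthonormal basis the coordinates are bounded by the norm, so the ball
    is a closed subset of the image of a cube. *)
Lemma compact_closed_ball0 (r : R) : compact [set x : X | `|x| <= r].
Proof.
have [m [b [ob bP]]] := orthonormal_basis.
pose comb (v : 'rV[R]_m) : X := \sum_i v 0 i *: b i.
have comb_cont : continuous comb.
  apply: continuous_sum => i v.
  exact: (cvgZr_tmp (@coord_continuous R 1 m 0 i v)).
pose Q := [set v : 'rV[R]_m | forall i, `[- r, r]%classic (v ord0 i)].
have cQ : compact Q.
  by apply: (@rV_compact _ m (fun=> `[- r, r]%classic)) => i; exact: segment_compact.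
have cI : compact (comb @` Q).
  by apply: continuous_compact => //; exact: continuous_subspaceT.
apply: (subclosed_compact _ cI).
  apply: (@preimage_closed _ _ (fun x : X => `|x|) [set y | y <= r]).
    by move=> x _; exact: norm_continuous.
  exact: closed_le.
move=> x /= xr; exists (\row_i dot x (b i)); last first.
  by rewrite [RHS]bP; apply: eq_bigr => i _; rewrite mxE.
move=> i /=; rewrite mxE in_itv /= -ler_norml.
apply: le_trans xr.
rewrite -(@ler_pXn2r _ 2) ?nnegrE // real_normK ?num_real //.
have := sqr_ge0 `|x - dot x (b i) *: b i|.
rewrite !hdot dotBl !dotBr !dotZl !dotZr (dotC dot (b i) x) ob eqxx mulr1; lra.
Qed.
End EuclideanSpace.

(** * Tangent cones *)

Section EpsilonDelta.
Context (R : realType) (E : normedModType R).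
Implicit Types (Omega : set E) (x y u : E).

Lemma nbhs_distP x (A : set E) :
  nbhs x A <-> exists2 e : R, 0 < e & forall y, `|y - x| < e -> A y.
Proof.
split=> [/nbhs_normP[e e0 eA]|[e e0 eA]].
  by exists e => // y ye; apply: eA; rewrite /ball_ /= distrC.
by apply/nbhs_normP; exists e => // y; rewrite /ball_ /= distrC; exact: eA.
Qed.

Lemma nbhs0_rightP (A : set R) :
  (0 : R)^'+ A <-> exists2 e : R, 0 < e & forall t, 0 < t -> t < e -> A t.
Proof.
split=> [/nbhs_normP[e e0 eA]|[e e0 eA]].
  exists e => // t t0 te; apply: eA => //.
  by rewrite /ball_ /= sub0r normrN gtr0_norm.
apply/nbhs_normP; exists e => // t; rewrite /ball_ /= sub0r normrN => te t0.
by apply: eA => //; rewrite -[t]gtr0_norm.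
Qed.

Lemma tangentP Omega x u : tangent_cone Omega x u <->
  forall e : R, 0 < e -> exists t y,
    [/\ 0 < t < e, Omega y & `|t^-1 *: (y - x) - u| < e].
Proof.
split=> [Tu e e0|Tu V /nbhs_distP[e1 e10 e1V] P /nbhs0_rightP[e2 e20 e2P]].
  have [||t /andP[t0 te] [_ [[y Oy <-] /= ye]]] :=
    Tu [set v | `|v - u| < e] _ [set t | 0 < t < e] _.
  - by apply/nbhs_distP; exists e.
  - by apply/nbhs0_rightP; exists e => // t t0 te; apply/andP.
  - by exists t, y; split => //; apply/andP.
have [|t [y [/andP[t0 te] Oy ye]]] := Tu (Num.min e1 e2).
  by rewrite lt_min e10 e20.
move: te ye; rewrite !lt_min => /andP[_ te2] /andP[ye1 _].
exists t; first exact: e2P.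
by exists (t^-1 *: (y - x)); split; [exists y | exact: e1V].
Qed.

Lemma nbhs_basepointP Omega x (P : set (E * R)) :
  filter_prod (within Omega (nbhs x)) (0 : R)^'+ P <->
  exists2 e : R, 0 < e & forall x' t, Omega x' -> `|x' - x| < e ->
    0 < t -> t < e -> P (x', t).
Proof.
split=> [[[A B] [/= /nbhs_distP[e1 e10 e1A] /nbhs0_rightP[e2 e20 e2B]] ABP]|].
  exists (Num.min e1 e2); first by rewrite lt_min e10 e20.
  move=> x' t Ox'; rewrite !lt_min => /andP[xe _] t0 /andP[_ te].
  by apply: ABP; split => /=; [exact: e1A | exact: e2B].
move=> [e e0 eP]; exists ([set x' | Omega x' /\ `|x' - x| < e],
                          [set t | 0 < t < e]).
  split=> /=; first by apply/nbhs_distP; exists e => // y ye Oy.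
  by apply/nbhs0_rightP; exists e => // t t0 te; apply/andP.
by move=> [x' t] [/= [Ox' xe] /andP[t0 te]]; exact: eP.
Qed.

Lemma paratingentP Omega x u : paratingent_cone Omega x u <->
  forall e : R, 0 < e -> exists t x' y,
    [/\ 0 < t < e, Omega x', `|x' - x| < e, Omega y &
        `|t^-1 *: (y - x') - u| < e].
Proof.
split=> [Tu e e0|Tu V /nbhs_distP[e1 e10 e1V] P /nbhs_basepointP[e2 e20 e2P]].
  have [||[x' t] [/= Ox' xe /andP[t0 te]] [_ [[y Oy <-] /= ye]]] :=
    Tu [set v | `|v - u| < e] _
      [set p | [/\ Omega p.1, `|p.1 - x| < e & 0 < p.2 < e]] _.
  - by apply/nbhs_distP; exists e.
  - apply/nbhs_basepointP; exists e => // x' t Ox' xe t0 te.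
    by split => //; apply/andP.
  - by exists t, x', y; split => //; apply/andP.
have [|t [x' [y [/andP[t0 te] Ox' xe Oy ye]]]] := Tu (Num.min e1 e2).
  by rewrite lt_min e10 e20.
move: te xe ye; rewrite !lt_min => /andP[_ te2] /andP[_ xe2] /andP[ye1 _].
exists (x', t); first exact: e2P.
by exists (t^-1 *: (y - x')); split; [exists y | exact: e1V].
Qed.

Lemma regular_tangentP Omega x u : regular_tangent_cone Omega x u <->
  forall e : R, 0 < e -> exists2 d : R, 0 < d &
    forall t x', 0 < t < d -> Omega x' -> `|x' - x| < d ->
      exists2 y, Omega y & `|t^-1 *: (y - x') - u| < e.
Proof.
split=> [Tu e e0|Tu V /nbhs_distP[e e0 eV]].
  have nu : nbhs u [set v | `|v - u| < e] by apply/nbhs_distP; exists e.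
  have /nbhs_basepointP[d d0 dP] := Tu _ nu.
  exists d => // t x' /andP[t0 td] Ox' xd.
  by have [_ [[y Oy <-] /= ye]] := dP x' t Ox' xd t0 td; exists y.
have [d d0 dP] := Tu e e0.
apply/nbhs_basepointP; exists d => // x' t Ox' xd t0 td.
have [|y Oy ye] := dP t x' _ Ox' xd; first exact/andP.
by exists (t^-1 *: (y - x')); split; [exists y | exact: eV].
Qed.

Lemma regular_sub_tangent Omega x : Omega x ->
  regular_tangent_cone Omega x `<=` tangent_cone Omega x.
Proof.
move=> Ox u /regular_tangentP Tu; apply/tangentP => e e0.
have [d d0 dP] := Tu e e0.
have m0 : 0 < Num.min d e by rewrite lt_min d0 e0.
pose t := Num.min d e / 2.
have t0 : 0 < t by rewrite divr_gt0.
have tm : t < Num.min d e by rewrite ltr_pdivrMr // ltr_pMr // ltr1n.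
move: (tm); rewrite lt_min => /andP[td te].
have [||y Oy ye] := dP t x _ Ox; first exact/andP.
  by rewrite subrr normr0.
by exists t, y; split => //; apply/andP.
Qed.

Lemma tangent_sub_paratingent Omega x : Omega x ->
  tangent_cone Omega x `<=` paratingent_cone Omega x.
Proof.
move=> Ox u /tangentP Tu; apply/paratingentP => e e0.
have [t [y [te Oy ye]]] := Tu e e0.
by exists t, x, y; split => //; rewrite subrr normr0.
Qed.

Lemma regular_sub_paratingent Omega x : Omega x ->
  regular_tangent_cone Omega x `<=` paratingent_cone Omega x.
Proof.
by move=> Ox u /(regular_sub_tangent Ox) /(tangent_sub_paratingent Ox).
Qed.

(** The base point and the end point of a difference quotient play symmetric
    roles: both tend to [x]. *)
Lemma paratingent_endpoints Omega x u : paratingent_cone Omega x u ->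
  forall e : R, 0 < e -> exists t x' y,
    [/\ 0 < t < e, Omega x' /\ `|x' - x| < e, Omega y /\ `|y - x| < e &
        `|t^-1 *: (y - x') - u| < e].
Proof.
move=> /paratingentP Tu e e0.
pose d := Num.min e (Num.min 1 (e / (2 * (`|u| + 2)))).
have u2 : 0 < 2 * (`|u| + 2) :> R.
  by rewrite mulr_gt0 // ltr_wpDl.
have d0 : 0 < d by rewrite !lt_min e0 ltr01 divr_gt0.
have [t [x' [y [/andP[t0 td] Ox' xd Oy yd]]]] := Tu d d0.
move: (td) (xd) (yd); rewrite /d !lt_min.
move=> /and3P[te t1 tu] /and3P[xe x1 xu] /and3P[ye y1 _].
exists t, x', y; split => //; [exact/andP|split => //].
have yE : y - x = t *: ((t^-1 *: (y - x') - u) + u) + (x' - x).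
  by rewrite subrK scalerA divff ?gt_eqF // scale1r addrA subrK.
have : `|y - x| <= t * (1 + `|u|) + `|x' - x|.
  rewrite yE (le_trans (ler_normD _ _)) // lerD2r normrZ gtr0_norm //.
  rewrite ler_pM2l // (le_trans (ler_normD _ _)) // lerD2r.
  exact: ltW.
move: tu xu; rewrite !ltr_pdivlMr // => tu xu le1.
have nu := normr_ge0 u; have nx := normr_ge0 (x' - x).
nra.
Qed.

Lemma paratingent0 Omega x : Omega x -> paratingent_cone Omega x 0.
Proof.
move=> Ox; apply/paratingentP => e e0; exists (e / 2), x, x.
rewrite !subrr scaler0 subr0 normr0; split => //.
by rewrite divr_gt0 // ltr_pdivrMr // ltr_pMr // ltr1n.
Qed.

Lemma paratingentN Omega x u :
  paratingent_cone Omega x u -> paratingent_cone Omega x (- u).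
Proof.
move=> /paratingent_endpoints Tu; apply/paratingentP => e e0.
have [t [x' [y [te [Ox' xe] [Oy ye] ue]]]] := Tu e e0.
exists t, y, x'; split => //.
by rewrite -[x' - y]opprB scalerN -opprD normrN.
Qed.

Lemma paratingent_pscale Omega x u (a : R) : 0 < a ->
  paratingent_cone Omega x u -> paratingent_cone Omega x (a *: u).
Proof.
move=> a0 /paratingentP Tu; apply/paratingentP => e e0.
pose d := Num.min e (Num.min (e * a) (e / a)).
have d0 : 0 < d by rewrite !lt_min e0 mulr_gt0 // divr_gt0.
have [t [x' [y [/andP[t0 td] Ox' xd Oy yd]]]] := Tu d d0.
move: td xd yd; rewrite /d !lt_min.
move=> /and3P[te ta _] /and3P[xe _ _] /and3P[_ _ ye].
exists (t / a), x', y; split => //.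
  by rewrite divr_gt0 // ltr_pdivrMr.
rewrite invfM invrK mulrC -scalerA -scalerBr normrZ gtr0_norm //.
by rewrite mulrC -ltr_pdivlMr.
Qed.

Lemma paratingentZ Omega x u (a : R) : Omega x ->
  paratingent_cone Omega x u -> paratingent_cone Omega x (a *: u).
Proof.
move=> Ox Tu; have [a0|a0|<-] := ltgtP 0 a; last 1 first.
- by rewrite scale0r; exact: paratingent0.
- exact: paratingent_pscale.
- rewrite -[a]opprK scaleNr; apply/paratingentN/paratingent_pscale => //.
  by rewrite oppr_gt0.
Qed.

(** A regular tangent direction is available from every nearby point of the
    set, in particular from the end point of the difference quotients that
    approximate a paratingent direction. *)
Lemma regular_add_paratingent Omega x u v :
  regular_tangent_cone Omega x u -> paratingent_cone Omega x v ->
  paratingent_cone Omega x (v + u).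
Proof.
move=> /regular_tangentP Tu /paratingent_endpoints Tv.
apply/paratingentP => e e0.
have e20 : 0 < e / 2 by rewrite divr_gt0.
have [d d0 dP] := Tu _ e20.
pose m := Num.min d (e / 2).
have m0 : 0 < m by rewrite lt_min d0 e20.
have [t [x' [y [/andP[t0 tm] [Ox' xm] [Oy ym] vm]]]] := Tv m m0.
move: tm xm ym vm; rewrite !lt_min.
move=> /andP[td te] /andP[_ xe] /andP[yd _] /andP[_ ve].
have [|z Oz ue] := dP t y _ Oy yd; first exact/andP.
have e2e : e / 2 < e by rewrite ltr_pdivrMr // ltr_pMr // ltr1n.
exists t, x', z; split => //; first by rewrite t0 (lt_trans te).
  exact: lt_trans e2e.
have -> : t^-1 *: (z - x') - (v + u) =
    (t^-1 *: (y - x') - v) + (t^-1 *: (z - y) - u).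
  rewrite addrACA -opprD -scalerDr; congr (_ *: _ - _).
  by rewrite [RHS]addrC addrA subrK.
apply: le_lt_trans (ler_normD _ _) _; lra.
Qed.

Lemma subspace_paratingent Omega x : Omega x ->
  regular_tangent_cone Omega x = paratingent_cone Omega x ->
  linear_subspace (paratingent_cone Omega x).
Proof.
move=> Ox eqT; split=> [|a u v Tu Tv]; first exact: paratingent0.
by apply: regular_add_paratingent; [rewrite eqT | exact: paratingentZ].
Qed.

(** A closed condition on difference quotients passes to paratingent vectors;
    their end points may be taken close to [x] as well. *)
Lemma paratingent_sub_closed Omega x (C : set E) (d : R) : 0 < d ->
  closed C ->
  (forall t p q, 0 < t -> Omega p -> Omega q -> `|p - x| < d -> `|q - x| < d ->
     C (t^-1 *: (q - p))) ->
  paratingent_cone Omega x `<=` C.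
Proof.
move=> d0 cC CO u /paratingent_endpoints Tu; rewrite closedE in cC.
apply: cC => /nbhs_distP[e e0 eC].
have [|t [p [q [/andP[t0 _] [Op pd] [Oq qd] ue]]]] := Tu (Num.min d e).
  by rewrite lt_min d0 e0.
move: pd qd ue; rewrite !lt_min => /andP[pd _] /andP[qd _] /andP[_ ue].
exact: (eC _ ue (CO t p q t0 Op Oq pd qd)).
Qed.

(** If the difference quotients of length one did not tend to the kernel of
    [l], a cluster point of them would be a paratingent direction outside of
    that kernel. *)
Lemma strict_approximation (Z : normedModType R) Omega x (l : {linear E -> Z}) :
  compact [set u : E | `|u| = 1] -> continuous l ->
  (forall u, paratingent_cone Omega x u -> l u = 0) ->
  forall e : R, 0 < e -> exists2 d : R, 0 < d &
    forall p q, Omega p -> Omega q -> `|p - x| < d -> `|q - x| < d ->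
      `|l (q - p)| <= e * `|q - p|.
Proof.
move=> cS lc Tl e e0.
pose C := [set u : E | `|u| = 1] `&` [set u | e <= `|l u|].
have cC : compact C.
  apply: compact_closedI => //.
  apply: (@preimage_closed _ _ (fun u => `|l u|) [set r | e <= r]).
    by move=> u _; apply: cvg_norm; exact: lc.
  exact: closed_ge.
pose P (d : R) (u : E) := forall t p q, 0 < t < d -> Omega p -> Omega q ->
  `|p - x| < d -> t^-1 *: (q - p) <> u.
have : \forall d \near (0 : R)^'+, C `<=` P d.
  have /compact_near_coveringP/(_ R (0 : R)^'+ P _) := cC.
  apply => u [/= u1 lu].
  have nTu : ~ paratingent_cone Omega x u.
    by move=> /Tl lu0; move: lu; rewrite lu0 normr0 leNgt e0.
  have [d d0 dP] : exists2 d : R, 0 < d & forall t p q, 0 < t < d -> Omega p ->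
      Omega q -> `|p - x| < d -> ~ `|t^-1 *: (q - p) - u| < d.
    apply: contrapT => nd; apply: nTu; apply/paratingentP => d d0.
    apply: contrapT => nq; apply: nd; exists d => // t p q td Op Oq pd ud.
    by apply: nq; exists t, p, q.
  exists ([set u' | `|u' - u| < d], [set d' | 0 < d' < d]).
    split; first by apply/nbhs_distP; exists d.
    by apply/nbhs0_rightP; exists d => // t t0 td; apply/andP.
  move=> [u' d'] [/= ud' /andP[d'0 d'd]] t p q /andP[t0 td'] Op Oq pd' qu'.
  apply: (dP t p q) => //; first by rewrite t0 (lt_trans td').
    exact: lt_trans d'd.
  by rewrite qu'.
move=> /nbhs0_rightP[d1 d10 d1P].
pose d := d1 / 4.
have d0 : 0 < d by rewrite divr_gt0.
(* The quarter leaves room for a step of length [`|q - p|], up to twice [d]. *)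
exists d => // p q Op Oq pd qd.
have [->|qp] := eqVneq q p; first by rewrite subrr linear0 !normr0 mulr0.
have t0 : 0 < `|q - p| by rewrite normr_gt0 subr_eq0.
have td : `|q - p| < d1 / 2.
  have -> : q - p = (q - x) - (p - x) by rewrite opprB addrA subrK.
  apply: le_lt_trans (ler_normB _ _) _; rewrite /d in pd qd; lra.
rewrite leNgt; apply/negP => lt1.
apply: (d1P (d1 / 2) _ _ (`|q - p|^-1 *: (q - p)) _ `|q - p| p q) => //.
- lra.
- lra.
- rewrite /C /= normrZ linearZ normrZ normfV normr_id mulVf ?gt_eqF //.
  by split => //; rewrite mulrC ler_pdivlMr // ltW.
- by rewrite t0.
- rewrite /d in pd; lra.
Qed.

End EpsilonDelta.

(** * Strict derivatives and their action on cones *)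

Lemma exists_linear (R : realType) (X Y : normedModType R) (h : X -> Y) :
  linear h -> exists H : {linear X -> Y}, h = H.
Proof.
move=> lh.
pose H : {linear X -> Y} := HB.pack h (GRing.isLinear.Build _ _ _ _ h lh).
by exists H.
Qed.

(** Strict differentiability with a bare function as derivative, so that
    compositions and pairs of derivatives need no bundled linear map. *)
Definition strict_derivative (R : realType) (E E' : normedModType R)
    (g : E -> E') (x : E) (D : E -> E') : Prop :=
  [/\ linear D, continuous D &
      forall e : R, 0 < e -> exists2 d : R, 0 < d & forall p q,
        `|p - x| < d -> `|q - x| < d ->
        `|g q - g p - D (q - p)| <= e * `|q - p|].

Section StrictDerivative.
Context (R : realType).
Implicit Types (E : normedModType R).

Lemma linear_bound E E' (D : E -> E') : linear D -> continuous D ->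
  exists2 M : R, 0 < M & forall u, `|D u| <= M * `|u|.
Proof.
move=> lD; have [D' ->] := exists_linear lD.
move=> /linear_bounded_continuous/linear_boundedP/pinfty_ex_gt0[M M0 DM].
by exists M.
Qed.

Lemma linearfB E E' (D : E -> E') : linear D -> forall u v, D (u - v) = D u - D v.
Proof.
move=> lD u v.
by rewrite addrC -scaleN1r lD scaleN1r addrC.
Qed.

Lemma linearfZ E E' (D : E -> E') : linear D -> forall a u, D (a *: u) = a *: D u.
Proof.
move=> lD a u.
have D0 : D 0 = 0 by rewrite -[X in D X](subrr 0) linearfB // subrr.
by have := lD a u 0; rewrite D0 !addr0.
Qed.

Lemma strict_derivative_continuous E E' (g : E -> E') x D :
  strict_derivative g x D -> forall e : R, 0 < e ->
  exists2 d : R, 0 < d & forall p, `|p - x| < d -> `|g p - g x| < e.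
Proof.
move=> [lD cD gD] e e0; have [M M0 DM] := linear_bound lD cD.
have [d d0 dP] := gD 1 ltr01.
have M1 : 0 < M + 1 by rewrite addr_gt0.
exists (Num.min d (e / (M + 1))); first by rewrite lt_min d0 divr_gt0.
move=> p; rewrite lt_min => /andP[pd]; rewrite ltr_pdivlMr // => pe.
have := dP x p; rewrite subrr normr0 => /(_ d0 pd) le1.
have -> : g p - g x = (g p - g x - D (p - x)) + D (p - x) by rewrite subrK.
have := DM (p - x) => le2.
apply: le_lt_trans (ler_normD _ _) _; lra.
Qed.

Lemma strict_derivative_lin E E' (D : E -> E') x :
  linear D -> continuous D -> strict_derivative D x D.
Proof.
move=> lD cD; split => // e e0; exists 1 => // p q _ _.
by rewrite linearfB // subrr normr0 mulr_ge0 // ltW.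
Qed.

Lemma strict_derivative_comp E E' E'' (g : E -> E') (h : E' -> E'') x D D' :
  strict_derivative g x D -> strict_derivative h (g x) D' ->
  strict_derivative (h \o g) x (D' \o D).
Proof.
move=> gD hD'; have [lD cD gP] := gD; have [lD' cD' hP] := hD'.
split=> [a u v /=|u|e e0].
- by rewrite lD lD'.
- by apply: continuous_comp; [exact: cD | exact: cD'].
have [M M0 DM] := linear_bound lD cD.
have [M' M'0 DM'] := linear_bound lD' cD'.
pose e1 := Num.min 1 (e / (2 * M')).
have e10 : 0 < e1 by rewrite lt_min ltr01 divr_gt0 // mulr_gt0.
pose e2 := e / (2 * (M + 1)).
have e20 : 0 < e2 by rewrite divr_gt0 // mulr_gt0 // addr_gt0.
have [d1 d10 d1P] := gP _ e10.
have [d2 d20 d2P] := hP _ e20.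
have [d3 d30 d3P] := strict_derivative_continuous gD d20.
exists (Num.min d1 d3); first by rewrite lt_min d10 d30.
move=> p q; rewrite !lt_min => /andP[pd1 pd3] /andP[qd1 qd3] /=.
have le1 := d1P _ _ pd1 qd1.
have le2 := d2P _ _ (d3P _ pd3) (d3P _ qd3).
have le3 := DM' (g q - g p - D (q - p)).
have le4 := DM (q - p).
have e1E : M' * e1 <= e / 2.
  apply: (@le_trans _ _ (M' * (e / (2 * M')))).
    by rewrite ler_pM2l // ge_min lexx orbT.
  by rewrite le_eqVlt; apply/orP; left; apply/eqP; field; rewrite gt_eqF.
have e2E : e2 * (M + 1) = e / 2.
  by rewrite /e2; field; rewrite gt_eqF // addr_gt0.
have e11 : e1 <= 1 by rewrite ge_min lexx.
have -> : h (g q) - h (g p) - D' (D (q - p)) =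
    (h (g q) - h (g p) - D' (g q - g p)) + D' (g q - g p - D (q - p)).
  by rewrite (linearfB lD' (g q - g p)) addrA subrK.
apply: le_trans (ler_normD _ _) _.
have le5 : `|g q - g p| <= (M + 1) * `|q - p|.
  have -> : g q - g p = (g q - g p - D (q - p)) + D (q - p) by rewrite subrK.
  apply: le_trans (ler_normD _ _) _.
  have : e1 * `|q - p| <= `|q - p| by rewrite ler_piMl.
  lra.
have le6 : e2 * `|g q - g p| <= e / 2 * `|q - p|.
  by rewrite -e2E -mulrA ler_pM2l.
have le7 : `|D' (g q - g p - D (q - p))| <= e / 2 * `|q - p|.
  apply: le_trans le3 _; apply: (@le_trans _ _ (M' * e1 * `|q - p|)).
    by rewrite -mulrA ler_pM2l.
  by rewrite ler_wpM2r.
lra.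
Qed.

Lemma norm_pair E E' (u : E) (v : E') (r : R) :
  (`|(u, v)| <= r) = (`|u| <= r) && (`|v| <= r).
Proof. by rewrite prod_normE /= ge_max. Qed.

Lemma norm_pair_lt E E' (u : E) (v : E') (r : R) :
  (`|(u, v)| < r) = (`|u| < r) && (`|v| < r).
Proof. by rewrite prod_normE /= gt_max. Qed.

Lemma strict_derivative_pair E E' E'' (g : E -> E') (h : E -> E'') x D D' :
  strict_derivative g x D -> strict_derivative h x D' ->
  strict_derivative (fun p => (g p, h p)) x (fun u => (D u, D' u)).
Proof.
move=> [lD cD gP] [lD' cD' hP]; split=> [a u v|u|e e0].
- by rewrite lD lD'.
- by apply: cvg_pair; [exact: cD | exact: cD'].
have [d1 d10 d1P] := gP _ e0; have [d2 d20 d2P] := hP _ e0.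
exists (Num.min d1 d2); first by rewrite lt_min d10 d20.
move=> p q; rewrite !lt_min => /andP[pd1 pd2] /andP[qd1 qd2].
rewrite -[X in `|X| <= _]/(g q - g p - D (q - p), h q - h p - D' (q - p)).
by rewrite norm_pair d1P // d2P.
Qed.

Lemma strict_derivative_fst E E' (p : E * E') : strict_derivative fst p fst.
Proof. by apply: strict_derivative_lin => // u; exact: cvg_fst. Qed.

Lemma strict_derivative_snd E E' (p : E * E') : strict_derivative snd p snd.
Proof. by apply: strict_derivative_lin => // u; exact: cvg_snd. Qed.

Lemma strict_derivativeD E E' (g h : E -> E') x D D' :
  strict_derivative g x D -> strict_derivative h x D' ->
  strict_derivative (fun p => g p + h p) x (fun u => D u + D' u).
Proof.
move=> gD hD'.
have := strict_derivative_pair gD hD'.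
move=> /strict_derivative_comp/(_ (strict_derivative_lin _ _ _)).
move=> /(_ E' (fun p => p.1 + p.2)); apply.
- by move=> a [u v] [u' v'] /=; rewrite scalerDr addrACA.
- by move=> [u v]; exact: add_continuous.
Qed.

Lemma strict_derivativeB E E' (g h : E -> E') x D D' :
  strict_derivative g x D -> strict_derivative h x D' ->
  strict_derivative (fun p => g p - h p) x (fun u => D u - D' u).
Proof.
move=> gD hD'; apply: strict_derivativeD => //.
apply: (strict_derivative_comp hD') (strict_derivative_lin _ _ _).
- by move=> a u v; rewrite opprD scalerN.
- exact: opp_continuous.
Qed.

Lemma strictly_differentiableP E E' (g : E -> E') x :
  strictly_differentiable g x <->
  differentiable g x /\ strict_derivative g x ('d g x).
Proof.
split=> [[dg gP]|[dg [_ _ gP]]]; split=> //.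
  split; [exact: linearP | exact: diff_continuous | move=> e e0].
  have := gP; move=> /cvgr0Pnorm_le/(_ e e0); rewrite near_withinE => /nbhs_distP.
  move=> [d d0 dP]; exists d => // p q pd qd.
  have [->|qp] := eqVneq q p; first by rewrite !subrr linear0 subrr !normr0 mulr0.
  have := dP (q, p) _ qp; rewrite /= normrZ normfV normr_id.
  rewrite mulrC ler_pdivrMr ?normr_gt0 ?subr_eq0 //; apply.
  rewrite -[X in `|X| < _]/(q - x, p - x).
  by rewrite norm_pair_lt pd qd.
apply/cvgr0Pnorm_le => e e0; rewrite near_withinE; apply/nbhs_distP.
have [d d0 dP] := gP e e0; exists d => // [[q p]].
rewrite -[X in `|X| < _]/(q - x, p - x) norm_pair_lt => /andP[qd pd] /= qp.
rewrite normrZ normfV normr_id mulrC ler_pdivrMr ?normr_gt0 ?subr_eq0 //.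
exact: dP.
Qed.

Lemma strict_derivative_diff E E' (g : E -> E') x (D : {linear E -> E'}) :
  strict_derivative g x D -> strictly_differentiable g x /\ 'd g x = D :> (E -> E').
Proof.
move=> gD; have [lD cD gP] := gD.
have gE : g \o shift x = cst (g x) + D +o_ (0 : E) id.
  apply/eqaddoP => e e0; apply/nbhs_distP.
  have [d d0 dP] := gP e e0; exists d => // u; rewrite subr0 => ud.
  have := dP x (u + x); rewrite subrr normr0 addrK => /(_ d0 ud).
  by rewrite -[X in `|X| <= _ -> _]addrA -opprD.
have dE := diff_unique cD gE.
have dg : differentiable g x.
  by apply/diff_locallyP; rewrite dE.
split => //; apply/strictly_differentiableP; split => //.
by rewrite dE.
Qed.

Section ConesUnderMaps.
Context (E E' : normedModType R) (Omega : set E) (Omega' : set E').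
Context (g : E -> E') (D : E -> E') (x : E).
Hypothesis gD : strict_derivative g x D.

Lemma strict_quotient (u : E) (e : R) : 0 < e -> exists2 d : R, 0 < d &
  forall t p q, 0 < t -> `|p - x| < d -> `|q - x| < d ->
    `|t^-1 *: (q - p) - u| < d -> `|t^-1 *: (g q - g p) - D u| < e.
Proof.
move=> e0; have [lD cD gP] := gD; have [M M0 DM] := linear_bound lD cD.
have u1 : 0 < `|u| + 1 by rewrite ltr_wpDl.
pose c := e / (2 * (`|u| + 1)).
have c0 : 0 < c by rewrite divr_gt0 // mulr_gt0.
have [d1 d10 d1P] := gP _ c0.
pose d := Num.min d1 (Num.min 1 (e / (2 * M))).
exists d; first by rewrite !lt_min d10 ltr01 divr_gt0 // mulr_gt0.
move=> t p q t0; rewrite !lt_min.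
move=> /and3P[pd _ _] /and3P[qd _ _] /and3P[_ q1 qe].
have {}qe : M * `|t^-1 *: (q - p) - u| < e / 2.
  by move: qe; rewrite ltr_pdivlMr ?mulr_gt0 // => qe; lra.
have le1 := d1P _ _ pd qd.
have -> : t^-1 *: (g q - g p) - D u =
    t^-1 *: (g q - g p - D (q - p)) + D (t^-1 *: (q - p) - u).
  rewrite (linearfB lD (t^-1 *: (q - p))) (linearfZ lD t^-1).
    rewrite [t^-1 *: (g q - g p - _)]scalerBr.
    by rewrite addrA subrK.
apply: le_lt_trans (ler_normD _ _) _.
have lt2 : `|t^-1 *: (q - p)| < `|u| + 1.
  rewrite -[X in `|X|](subrK u); apply: le_lt_trans (ler_normD _ _) _.
  by rewrite addrC ltrD2l.
have le3 : `|t^-1 *: (g q - g p - D (q - p))| <= e / 2.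
  rewrite normrZ; apply: (@le_trans _ _ (`|t^-1| * (c * `|q - p|))).
    exact: ler_wpM2l.
  rewrite mulrCA -normrZ; apply: (@le_trans _ _ (c * (`|u| + 1))).
    by rewrite ler_pM2l // ltW.
  by rewrite le_eqVlt; apply/orP; left; apply/eqP; rewrite /c; field; rewrite gt_eqF.
have := DM (t^-1 *: (q - p) - u); lra.
Qed.

(** The two end points of a difference quotient move together, which is what
    strict differentiability controls. *)
Lemma paratingent_image (d : R) : 0 < d ->
  (forall p, Omega p -> `|p - x| < d -> Omega' (g p)) ->
  forall u, paratingent_cone Omega x u -> paratingent_cone Omega' (g x) (D u).
Proof.
move=> d0 OO' u /paratingent_endpoints Tu; apply/paratingentP => e e0.
have [d1 d10 d1P] := strict_quotient u e0.
have [d2 d20 d2P] := strict_derivative_continuous gD e0.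
pose m := Num.min (Num.min d e) (Num.min d1 d2).
have [|t [p [q [/andP[t0 tm] [Op pm] [Oq qm] um]]]] := Tu m.
  by rewrite !lt_min d0 e0 d10 d20.
move: tm pm qm um; rewrite !lt_min.
move=> /andP[/andP[_ te] _] /andP[/andP[pd _] /andP[pd1 pd2]].
move=> /andP[/andP[qd _] /andP[qd1 _]] /andP[_ /andP[ud1 _]].
exists t, (g p), (g q); split; rewrite ?t0 //.
- exact: OO'.
- exact: d2P.
- exact: OO'.
- exact: d1P.
Qed.

(** Here [h] transports base points near [g x] back to base points near [x],
    from where the regular tangent directions are available. *)
Lemma regular_tangent_image (h : E' -> E) (Dh : E' -> E) (d : R) : 0 < d ->
  (forall p, Omega p -> `|p - x| < d -> Omega' (g p)) ->
  strict_derivative h (g x) Dh -> h (g x) = x ->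
  (forall p', Omega' p' -> `|p' - g x| < d -> Omega (h p') /\ g (h p') = p') ->
  forall u, regular_tangent_cone Omega x u ->
    regular_tangent_cone Omega' (g x) (D u).
Proof.
move=> d0 OO' hD hgx hO u /regular_tangentP Tu; apply/regular_tangentP => e e0.
have [d1 d10 d1P] := strict_quotient u e0.
pose d2 := Num.min d (Num.min d1 1).
have d20 : 0 < d2 by rewrite !lt_min d0 d10 ltr01.
have [d3 d30 d3P] := Tu _ d20.
pose u1 := `|u| + 1.
have u10 : 0 < u1 by rewrite ltr_wpDl.
pose d4 := Num.min d3 (d2 / 2).
have d40 : 0 < d4 by rewrite lt_min d30 divr_gt0.
have [d5 d50 d5P] := strict_derivative_continuous hD d40.
exists (Num.min (Num.min d d5) (Num.min d3 (d2 / (2 * u1)))).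
  by rewrite !lt_min d0 d50 d30 divr_gt0 // mulr_gt0.
move=> t p'; rewrite !lt_min => /andP[t0 /andP[_ /andP[td3 tu]]] Op'.
move=> /andP[/andP[pd pd5] _].
have [Ohp ghp] := hO p' Op' pd.
have := d5P _ pd5; rewrite hgx lt_min => /andP[hd3 hd2].
have [|q Oq uq] := d3P t (h p') _ Ohp hd3; first by rewrite t0.
have td2 : t * u1 < d2 / 2.
  by move: tu; rewrite ltr_pdivlMr ?mulr_gt0 // => tu; lra.
move: (uq); rewrite /d2 !lt_min => /and3P[_ uq1 uq2].
have qx : `|q - x| < d2.
  have -> : q - x = t *: ((t^-1 *: (q - h p') - u) + u) + (h p' - x).
    by rewrite subrK scalerA divff ?gt_eqF // scale1r addrA subrK.
  apply: le_lt_trans (ler_normD _ _) _.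
  have : `|t *: (t^-1 *: (q - h p') - u + u)| <= t * u1.
    rewrite normrZ gtr0_norm // ler_pM2l //.
    apply: le_trans (ler_normD _ _) _; rewrite /u1 addrC lerD2l.
    exact: ltW.
  lra.
move: qx; rewrite /d2 !lt_min => /and3P[qd qd1 _].
exists (g q); first exact: OO'.
rewrite -ghp; apply: d1P => //; apply: lt_le_trans hd2 _.
rewrite /d2; apply: (@le_trans _ _ d2); last by rewrite !ge_min lexx orbT.
by rewrite ler_pdivrMr // ler_peMr // ?ltW // ltr1n.
Qed.

End ConesUnderMaps.

End StrictDerivative.

Lemma strict_derivative_ray (R : realType) (E E' : normedModType R)
    (g : E -> E') (x : E) (D : E -> E') (y : E) : strict_derivative g x D ->
  t^-1 *: (g (x + t *: y) - g x) @[t --> (0 : R)^'+] --> D y.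
Proof.
move=> gD; apply/cvgrPdist_lt => e e0.
have [d d0 dP] := strict_quotient gD y e0.
have y1 : 0 < `|y| + 1 by rewrite ltr_wpDl.
apply/nbhs0_rightP; exists (d / (`|y| + 1)); first exact: divr_gt0.
move=> t t0; rewrite ltr_pdivlMr // => td.
rewrite distrC; apply: dP => //.
- by rewrite subrr normr0.
- rewrite (addrC x) addrK normrZ gtr0_norm //.
  by apply: le_lt_trans td; rewrite ler_pM2l // lerDl.
- by rewrite (addrC x) addrK scalerA mulVf ?gt_eqF // scale1r subrr normr0.
Qed.

(** * Lagrangian subspaces *)

Section SymplecticLinearAlgebra.
Context (R : realType) (X : normedModType R) (dot : {dot X for (@idfun R)}).
Hypotheses (hfin : finite_dimensional X) (hdot : induces_norm dot).
Implicit Types (x y z u v w : X) (H L T Q : {linear X -> X}).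

Lemma linear_inverse T : (forall x, T x = 0 -> x = 0) ->
  exists T' : {linear X -> X}, forall x, T (T' x) = x.
Proof.
move=> Tinj; have /choice[g gP] := linear_inj_surj hfin hdot Tinj.
have [|T' gE] := @exists_linear R X X g.
  move=> a x y; apply/eqP; rewrite -subr_eq0; apply/eqP/Tinj.
  by rewrite linearB linearP !gP subrr.
by exists T' => x; rewrite -gE.
Qed.

(** Hypomonotonicity makes [v + rho *: w], for any [rho > r], injective on [W],
    hence [W] is not larger than [X]; lifting a basis of [X] through [v + L w]
    then already exhausts [W]. *)
Lemma graph_of_hypomonotone_subspace (W : set (X * X)) L (r : R) :
  linear_subspace W ->
  (forall w v, W (w, v) -> - r * `|w| ^+ 2 <= dot v w) ->
  (forall y, exists w, W (w, y - L w)) ->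
  exists H, forall w v, W (w, v) <-> w = H (v + L w).
Proof.
move=> sW mono surj.
have [m [b [ob bP]]] := orthonormal_basis hfin hdot.
have /choice[c cP] : forall i, exists w, W (w, b i - L w) by move=> i.
pose h y := \sum_i dot y (b i) *: c i.
have [|H hE] := @exists_linear R X X h.
  move=> a x y; rewrite /h scaler_sumr -big_split; apply: eq_bigr => i _ /=.
  by rewrite dotDl dotZl scalerDl scalerA.
have WH y : W (H y, y - L (H y)).
  have -> : (H y, y - L (H y)) = \sum_i dot y (b i) *: (c i, b i - L (c i)).
    rewrite [RHS]surjective_pairing !raddf_sum /= -hE; congr (_, _).
    under [RHS]eq_bigr do rewrite scalerBr.
    rewrite sumrB -bP; congr (_ - _); rewrite linear_sum.
    by apply: eq_bigr => i _; rewrite linearZ.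
  by apply: subspace_sum => // i; exact: subspaceZ.
pose rho := r + 1.
have W0 w v : W (w, v) -> v + rho *: w = 0 -> w = 0 /\ v = 0.
  move=> Wwv /eqP; rewrite addr_eq0 => /eqP vE.
  have := mono _ _ Wwv; rewrite vE dotNl dotZl -hdot /rho => le0.
  have /eqP : `|w| ^+ 2 = 0.
    by apply/eqP; rewrite eq_le sqr_ge0 andbT; lra.
  by rewrite sqrf_eq0 normr_eq0 => /eqP ->; rewrite scaler0 oppr0.
have [|T TE] := @exists_linear R X X (fun y => y - L (H y) + rho *: H y).
  move=> a x y; rewrite !(linearP H) (linearP L) !scalerDr scalerN opprD !scalerA.
  rewrite [rho * a]mulrC.
  by rewrite (addrACA (a *: x)) [LHS]addrACA.
have Tinj y : T y = 0 -> y = 0.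
  rewrite -TE => /(W0 _ _ (WH y))[Hy0].
  by rewrite Hy0 linear0 subr0.
exists H => w v; split=> [Wwv|wE]; last first.
  by have := WH (v + L w); rewrite -wE addrK.
have [y yE] := linear_inj_surj hfin hdot Tinj (v + rho *: w).
have [] := W0 (w - H y) (v - (y - L (H y))).
- exact: (subspaceB sW Wwv (WH y)).
- by rewrite scalerBr addrACA -opprD -yE -TE subrr.
move=> /eqP; rewrite subr_eq0 => /eqP -> /eqP; rewrite subr_eq0 => /eqP ->.
by rewrite subrK.
Qed.

Definition orth_compl (K : set X) : set X :=
  [set z | forall q, K q -> dot z q = 0].

Lemma range_subspace H : linear_subspace (range H).
Proof.
split=> [|a _ _ [x _ <-] [y _ <-]]; first by exists 0 => //; rewrite linear0.
by exists (a *: x + y) => //; rewrite linearP.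
Qed.

Lemma symmetric_kernel Q z : symmetric_map dot Q ->
  orth_compl (range Q) z <-> Q z = 0.
Proof.
move=> symQ; split=> [zQ|Qz _ [x _ <-]]; last by rewrite -symQ Qz dot0l.
by apply: (dot_eq0 hdot); rewrite symQ; apply: zQ; exists (Q z).
Qed.

Lemma symmetric_range Q w : symmetric_map dot Q ->
  (forall z, Q z = 0 -> dot w z = 0) -> range Q w.
Proof.
move=> symQ wQ; pose K := range Q.
have sK : linear_subspace K by exact: range_subspace.
have [Kp pO] := projection_orth hfin hdot sK w.
have zQ : Q (w - projection K w) = 0 by apply/(symmetric_kernel _ symQ).
have : w - projection K w = 0.
  apply: (dot_eq0 hdot); rewrite dotBr (pO _ Kp) subr0 (dotC dot); exact: wQ.
by move=> /eqP; rewrite subr_eq0 => /eqP ->.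
Qed.

(** The symmetry hypothesis says that the subspace [w = H (v + L w)] is
    Lagrangian. Over the coordinate [z = v + rho *: w] it is the graph of a
    map [Q] which, unlike [H], is symmetric, so that its range is the
    orthogonal complement of its kernel. *)
Lemma lagrangian_coordinates H L (rho : R) :
  let M := fun y => y - L (H y) in
  (forall a b, dot (M a) (H b) = dot (M b) (H a)) ->
  (forall y, M y + rho *: H y = 0 -> y = 0) ->
  exists Q, [/\ symmetric_map dot Q, range Q = range H,
    forall z, Q z = 0 -> exists2 y, H y = 0 & z = M y &
    forall w v, w = H (v + L w) <-> w = Q (v + rho *: w)].
Proof.
move=> M symM Ninj.
have [|N NE] := @exists_linear R X X (fun y => M y + rho *: H y).
  move=> a x y.
  rewrite /M !(linearP H) (linearP L) !scalerDr scalerN opprD !scalerA.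
  rewrite [rho * a]mulrC.
  by rewrite (addrACA (a *: x)) [LHS]addrACA.
have [|g gP] := @linear_inverse N; first by move=> x; rewrite -NE; exact: Ninj.
have gN y : g (N y) = y.
  apply/eqP; rewrite -subr_eq0; apply/eqP/Ninj.
  by rewrite -[LHS]/((fun y => M y + rho *: H y) _) NE linearB gP subrr.
have [|Q QE] := @exists_linear R X X (H \o g); first exact: linearP.
have {}QE z : Q z = H (g z) by rewrite -QE.
have NEy y : N y = M y + rho *: H y by rewrite -NE.
exists Q; split.
- move=> z z'; rewrite -(gP z) -(gP z') !QE !gN !NEy dotDr dotDl dotZl dotZr.
  by rewrite -symM (dotC dot _ (M (g z'))).
- apply/seteqP; split=> [_ [z _ <-]|_ [y _ <-]]; first by rewrite QE; exists (g z).
  by exists (N y) => //; rewrite QE gN.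
- move=> z Qz; exists (g z); first by rewrite -QE.
  by rewrite -{1}(gP z) NEy -QE Qz scaler0 addr0.
- move=> w v; rewrite QE; split=> wE.
    have {2}-> : w = H (v + L w) by [].
    have {1}-> : v = M (v + L w) by rewrite /M -wE addrK.
    by rewrite -NEy gN.
  set y := g (v + rho *: w) in wE.
  have : N y = v + rho *: w by rewrite gP.
  rewrite NEy -wE => /addIr; rewrite /M -wE => <-.
  by rewrite subrK.
Qed.

(** [Q] is invertible on its range, because its kernel is the orthogonal
    complement. The map [A] is that inverse minus [rho], extended by zero to
    the complement; the component of [v] along the kernel of [Q] stays free. *)
Lemma symmetric_part_exists Q (rho : R) : symmetric_map dot Q ->
  exists A : {linear X -> X}, symmetric_map dot A /\
    forall w v, w = Q (v + rho *: w) <->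
      range Q w /\ orth_compl (range Q) (v - A w).
Proof.
move=> symQ; pose K := range Q.
have sK : linear_subspace K by exact: range_subspace.
have [P PE] := exists_linear (projection_linear hfin hdot sK).
have KP x : K (P x) by rewrite -PE; have [] := projection_orth hfin hdot sK x.
have OP x : orth_compl K (x - P x).
  by rewrite -PE; have [] := projection_orth hfin hdot sK x.
have PK x : K x -> P x = x.
  move=> Kx; rewrite -PE; apply: (projection_eq hdot) => // q _.
  by rewrite subrr dot0l.
have symP x y : dot (P x) y = dot x (P y).
  by rewrite -PE; exact: (projection_sym hfin hdot).
have KO x : K x -> orth_compl K x -> x = 0.
  by move=> Kx Ox; apply: (dot_eq0 hdot); exact: Ox.
(* [T] is [Q] on the range and the identity on the kernel. *)
have [|T TE] := @exists_linear R X X (fun x => Q x + (x - P x)).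
  move=> a x y; rewrite (linearP P) (linearP Q) !scalerDr scalerN opprD.
  by rewrite (addrACA (a *: x)) [LHS]addrACA.
have {}TE x : T x = Q x + (x - P x) by rewrite -TE.
have KQ x : K (Q x) by exists x.
have T0 x k : K k -> T x = k -> Q x = k /\ P x = x.
  move=> Kk /eqP; rewrite TE addrC -subr_eq0 -addrA addr_eq0 opprB => /eqP xE.
  have xP0 : x - P x = 0.
    by apply: KO => //; rewrite xE; exact: subspaceB.
  split; last by apply/esym/eqP; rewrite -subr_eq0 xP0.
  by apply/esym/eqP; rewrite -subr_eq0 -xE xP0.
have Tinj x : T x = 0 -> x = 0.
  move=> /(T0 _ _ (subspace0 sK))[Q0 PxE].
  by apply: KO; [rewrite -PxE | exact/(symmetric_kernel _ symQ)].
have [T' T'P] := linear_inverse Tinj.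
have symT : symmetric_map dot T.
  move=> x y; rewrite !TE !dotDl !dotDr !dotNl !dotNr symQ symP.
  by [].
have symT' : symmetric_map dot T'.
  by move=> x y; rewrite -{2}(T'P x) -{1}(T'P y) symT.
have [|A AE] := @exists_linear R X X (fun x => P (T' (P x)) - rho *: P x).
  move=> a x y; rewrite (linearP P a x y) (linearP T') (linearP P).
  by rewrite !scalerDr scalerN opprD addrACA !scalerA [rho * a]mulrC.
have {}AE x : A x = P (T' (P x)) - rho *: P x by rewrite -AE.
exists A; split.
  move=> x y; rewrite !AE dotBl dotBr dotZl dotZr !symP symT' symP.
  by [].
have uP w : K w -> Q (P (T' w)) = w.
  by move=> Kw; have [QE PE'] := T0 _ w Kw (T'P w); rewrite PE'.
move=> w v; split=> [wE|[Kw Ov]].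
  have Kw : K w by rewrite wE.
  split => //; apply/(symmetric_kernel _ symQ).
  by rewrite AE (PK w Kw) opprB addrA linearB -wE uP // subrr.
have -> : v + rho *: w = P (T' w) + (v - A w).
  by rewrite AE (PK w Kw) opprB addrCA [P _ + _]addrC subrK.
rewrite linearD uP //.
by have /(symmetric_kernel _ symQ) -> := Ov; rewrite addr0.
Qed.

End SymplecticLinearAlgebra.

(** * Second-order behaviour of prox-regular functions *)

Section Loops.
Context (R : realType) (X : normedModType R) (dot : {dot X for (@idfun R)}).
Implicit Types (p q d a b : X).

(** [U t] stands for a second-order difference quotient at scale [t]. No limit
    of it is assumed to exist: only lower bounds in the limit are recorded. *)
Definition asymptotic_gap (U : R -> X -> R) p q (c : R) : Prop :=
  forall e : R, 0 < e -> \forall t \near (0 : R)^'+, c - e <= U t q - U t p.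

Lemma asymptotic_gap_trans U p q s c c' :
  asymptotic_gap U p q c -> asymptotic_gap U q s c' ->
  asymptotic_gap U p s (c + c').
Proof.
move=> Upq Uqs e e0; have e20 : 0 < e / 2 by rewrite divr_gt0.
apply: filterS2 (Upq _ e20) (Uqs _ e20) => t; lra.
Qed.

Lemma asymptotic_gap_loop U p c : asymptotic_gap U p p c -> c <= 0.
Proof.
move=> Upp; apply/ler_addgt0Pl => e e0; rewrite addr0.
have /nbhs0_rightP[d d0 /(_ (d / 2))] := Upp e e0.
rewrite subrr divr_gt0 // ltr_pdivrMr // ltr_pMr // ltr1n => /(_ isT isT); lra.
Qed.

(** Summing the inequalities along a closed polygon with ever shorter steps
    makes the quadratic error disappear: each bisection of the steps halves
    it. What remains around a parallelogram is the skew part. *)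
Lemma symmetric_of_asymptotic_gap (U : R -> X -> R) (M H : {linear X -> X})
    (r : R) :
  (forall p q, asymptotic_gap U p q
     (dot (M p) (H (q - p)) - r / 2 * `|H (q - p)| ^+ 2)) ->
  forall a b, dot (M a) (H b) = dot (M b) (H a).
Proof.
move=> gap.
pose defect d := 2^-1 * dot (M d) (H d) + r / 2 * `|H d| ^+ 2.
(* A bisection divides the defect of each step by four and doubles the number
   of steps. *)
have step n p d : asymptotic_gap U p (p + d)
    (dot (M p) (H d) + 2^-1 * dot (M d) (H d) - 2^-1 ^+ n * defect d).
  elim: n p d => [|n IHn] p d.
    have := gap p (p + d); rewrite (addrAC p) subrr add0r /defect expr0 mul1r => h e e0.
    by apply: filterS (h e e0) => t; lra.
  pose h := 2^-1 *: d.
  have dE : h + h = d by rewrite -scalerDl -div1r -splitr scale1r.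
  have := asymptotic_gap_trans (IHn p h) (IHn (p + h) h).
  rewrite -addrA dE => gapn e e0.
  apply: filterS (gapn e e0) => t; rewrite /defect /h (linearD M) !(linearZ_LR M).
  rewrite !(linearZ_LR H) /= dotDl !dotZl !dotZr !normrZ exprMn.
  rewrite gtr0_norm ?invr_gt0 // (exprS _ n).
  move: (_ ^+ n) => c; lra.
have le a b : dot (M a) (H b) - dot (M b) (H a) <= 0.
  pose C := 2 * (defect a + defect b).
  have leC n : dot (M a) (H b) - dot (M b) (H a) <= 2^-1 ^+ n * C.
    have g1 := step n 0 a; have g2 := step n (0 + a) b.
    have g3 := step n (0 + a + b) (- a); have g4 := step n (0 + a + b - a) (- b).
    have := asymptotic_gap_trans (asymptotic_gap_trans g1 g2)
              (asymptotic_gap_trans g3 g4).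
    have -> : 0 + a + b - a - b = 0 by rewrite add0r (addrC a) addrK subrr.
    move=> /asymptotic_gap_loop; rewrite /C /defect !add0r (addrC a b) addrK.
    rewrite !(linearN M) !(linearN H) (linearD M) (linear0 M).
    rewrite !dotNl !dotNr !dotDl !dot0l !normrN.
    move: (_ ^+ n) => c; lra.
  have cvg0 : (fun n => (2^-1 : R) ^+ n * C) @ \oo --> (0 : R).
    rewrite -[0](mul0r C); apply: cvgMr_tmp; apply: cvg_expr.
    by rewrite gtr0_norm ?invr_gt0 // invf_lt1 // ltr1n.
  rewrite -(cvg_lim _ cvg0) //.
  by apply: limr_ge; [apply/cvg_ex; exists 0 | exact: nearW].
move=> a b; apply/eqP; rewrite eq_le -[X in X && _]subr_le0 -[X in _ && X]subr_le0.
by rewrite !le.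
Qed.

End Loops.

Section ProxRegular.
Context (R : realType) (X : normedModType R) (dot : {dot X for (@idfun R)}).
Context (f : X -> \bar R) (xbar vbar : X).

Local Notation df := (subdifferential dot f).

Definition uniform_subgradient_inequality (d r : R) : Prop :=
  forall x v x', df x v -> `|x - xbar| < d -> `|v - vbar| < d ->
    `|x' - xbar| < d ->
    (f x + (dot v (x' - x) - r / 2 * `|x' - x| ^+ 2)%:E <= f x')%E.

(** Subdifferential continuity turns closeness of [(x, v)] into closeness of
    [f x], which removes the side condition on [f x]. *)
Lemma prox_regular_uniform : prox_regular dot f xbar vbar ->
  subdifferentially_continuous dot f xbar vbar ->
  exists d r : R, 0 < d /\ uniform_subgradient_inequality d r.
Proof.
move=> [fx _ dfx [e [r [e0 r0 H]]]] sc.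
have [d d0 dP] : exists2 d : R, 0 < d & forall x v, df x v ->
    `|x - xbar| < d -> `|v - vbar| < d -> (f x < f xbar + e%:E)%E.
  apply: contrapT => nd.
  have /choice[c cP] : forall n : nat, exists p : X * X,
      [/\ df p.1 p.2, `|p.1 - xbar| < n.+1%:R^-1, `|p.2 - vbar| < n.+1%:R^-1 &
          ~ (f p.1 < f xbar + e%:E)%E].
    move=> n; apply: contrapT => np; apply: nd.
    exists n.+1%:R^-1; first by rewrite invr_gt0 ltr0n.
    move=> x v dxv xd vd; apply: contrapT => nf; apply: np.
    by exists (x, v).
  have cvgs (u : nat -> X) (l : X) :
      (forall n, `|u n - l| < n.+1%:R^-1) -> u @ \oo --> l.
    move=> ul; apply/cvgrPdist_lt => a a0.
    have [N _ NP] := near_infty_natSinv_lt (PosNum a0).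
    exists N => // n /NP /= na; rewrite distrC; exact: lt_trans (ul n) na.
  have fc : f \o (fun n => (c n).1) @ \oo --> f xbar.
    apply: (sc _ (fun n => (c n).2)) => [k||].
    - by have [] := cP k.
    - by apply: cvgs => n; have [] := cP n.
    - by apply: cvgs => n; have [] := cP n.
  have : \forall n \near \oo, (f (c n).1 < f xbar + e%:E)%E.
    have /fc : nbhs (f xbar) [set y | (y < f xbar + e%:E)%E].
      apply: open_nbhs_nbhs; split; first exact: open_ereal_lt_ereal.
      by move: fx => /fineK <-; rewrite /= -EFinD lte_fin ltrDl.
    by [].
  move=> [N _ /(_ N (leqnn N))]; by have [_ _ _] := cP N.
exists (Num.min d (e / 2)), r; split; first by rewrite lt_min d0 divr_gt0.
move=> x v x' dxv; rewrite !lt_min.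
move=> /andP[xd xe] /andP[vd ve] /andP[_ x'e].
apply: H => //; last 2 first.
- exact: dP vd.
- by lra.
apply: (@le_trans _ _ (Num.sqrt (e ^+ 2))); last first.
  by rewrite sqrtr_sqr ger0_norm // ltW.
apply: ler_wsqrtr.
have := normr_ge0 (x - xbar); have := normr_ge0 (v - vbar); nra.
Qed.

End ProxRegular.

Section SecondOrder.
Context (R : realType) (X : normedModType R) (dot : {dot X for (@idfun R)}).
Hypotheses (hdot : induces_norm dot).
Context (f : X -> \bar R) (xbar vbar : X) (d r : R).
Local Notation df := (subdifferential dot f).
Hypotheses (d0 : 0 < d) (hf : proper_fun f) (fxbar : f xbar \is a fin_num)
  (dfbar : df xbar vbar)
  (ineq : uniform_subgradient_inequality dot f xbar vbar d r).
Context (M H : {linear X -> X}) (xt vt : R -> X -> X).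
Hypotheses
  (graph_t : forall y, \forall t \near (0 : R)^'+, df (xt t y) (vt t y))
  (xt_quotient : forall y,
     t^-1 *: (xt t y - xbar) @[t --> (0 : R)^'+] --> H y)
  (vt_quotient : forall y,
     t^-1 *: (vt t y - vbar) @[t --> (0 : R)^'+] --> M y).

Lemma near_of_quotient (u : R -> X) (l x : X) (e : R) : 0 < e ->
  t^-1 *: (u t - x) @[t --> (0 : R)^'+] --> l ->
  \forall t \near (0 : R)^'+, `|u t - x| < e.
Proof.
move=> e0 ul.
have l1 : 0 < `|l| + 1 by rewrite ltr_wpDl.
have nl : \forall t \near (0 : R)^'+, `|t^-1 *: (u t - x)| < `|l| + 1.
  by apply: (cvgr_lt `|l|); [exact: cvg_norm | rewrite ltrDl].
have nt : \forall t \near (0 : R)^'+, 0 < t /\ t < e / (`|l| + 1).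
  by apply/nbhs0_rightP; exists (e / (`|l| + 1)); first exact: divr_gt0.
apply: filterS2 nl nt => t lt1 [t0]; rewrite ltr_pdivlMr // => lt2.
apply: le_lt_trans lt2.
move: lt1; rewrite normrZ gtr0_norm ?invr_gt0 // mulrC ltr_pdivrMr // mulrC.
exact: ltW.
Qed.

Let near_pos : \forall t \near (0 : R)^'+, 0 < t.
Proof. by apply/nbhs0_rightP; exists 1. Qed.

Let U (t : R) (x : X) : R :=
  t^-1 ^+ 2 * (fine (f x) - fine (f xbar) - dot vbar (x - xbar)).

Lemma fine_ineq x v x' : df x v -> `|x - xbar| < d -> `|v - vbar| < d ->
  `|x' - xbar| < d -> f x' \is a fin_num ->
  fine (f x) + (dot v (x' - x) - r / 2 * `|x' - x| ^+ 2) <= fine (f x').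
Proof.
move=> dxv xd vd x'd ffin; have := ineq dxv xd vd x'd.
have fx : f x \is a fin_num by case: dxv.
by rewrite -(fineK fx) -(fineK ffin) -EFinD lee_fin.
Qed.

Let scaled_ineq t x v x' : 0 < t -> df x v -> `|x - xbar| < d ->
  `|v - vbar| < d -> `|x' - xbar| < d -> f x' \is a fin_num ->
  let q := t^-1 *: (x' - xbar) - t^-1 *: (x - xbar) in
  dot (t^-1 *: (v - vbar)) q - r / 2 * `|q| ^+ 2 <= U t x' - U t x.
Proof.
move=> t0 dxv xd vd x'd ffin.
have := fine_ineq dxv xd vd x'd ffin.
have -> : t^-1 *: (x' - xbar) - t^-1 *: (x - xbar) = t^-1 *: (x' - x).
  by rewrite -scalerBr opprB addrA subrK.
rewrite /= normrZ dotZl dotZr exprMn.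
rewrite (gtr0_norm (_ : 0 < t^-1)) ?invr_gt0 // /U.
have : 0 < t^-1 ^+ 2 by rewrite exprn_gt0 // invr_gt0.
rewrite mulrA -expr2; move: (t^-1 ^+ 2) => c c0.
rewrite dotBl !dotBr; set dd := `|_| ^+ 2 => le1.
have : c * (fine (f x) + (dot v x' - dot v x - r / 2 * dd)) <= c * fine (f x').
  by rewrite ler_pM2l.
lra.
Qed.

(** The subgradient inequality from the point of the curve at [p] to the one at
    [q], divided by the square of [t]. *)
Lemma curve_gap p q : asymptotic_gap (fun t y => U t (xt t y)) p q
  (dot (M p) (H (q - p)) - r / 2 * `|H (q - p)| ^+ 2).
Proof.
move=> e e0.
have cvgq : t^-1 *: (xt t q - xbar) - t^-1 *: (xt t p - xbar)
    @[t --> (0 : R)^'+] --> H (q - p).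
  by rewrite linearB; apply: cvgB.
pose q_ t := t^-1 *: (xt t q - xbar) - t^-1 *: (xt t p - xbar).
pose phi t := dot (t^-1 *: (vt t p - vbar)) (q_ t) - r / 2 * `|q_ t| ^+ 2.
set L := (X in X - e); have cvgl : phi t @[t --> (0 : R)^'+] --> L.
  apply: cvgB; first by apply: (cvg_dot hdot).
  by apply: cvgMl_tmp; rewrite expr2; under eq_fun do rewrite expr2;
    apply: cvgM; apply: cvg_norm.
have lt1 : \forall t \near (0 : R)^'+, L - e < phi t.
  by apply: (cvgr_gt _ cvgl); rewrite gtrBl.
have lt2 := near_of_quotient d0 (@xt_quotient p).
have lt3 := near_of_quotient d0 (@xt_quotient q).
have lt4 := near_of_quotient d0 (@vt_quotient p).
have gp := graph_t p; have gq := graph_t q.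
near=> t; apply: (@le_trans _ _ (phi t)); first by apply: ltW; near: t.
apply: scaled_ineq; [near: t; exact: near_pos|by near: t|by near: t|by near: t|by near: t|].
have [] : df (xt t q) (vt t q) by near: t.
by [].
Unshelve. all: by end_near. Qed.

Lemma curves_lagrangian a b : dot (M a) (H b) = dot (M b) (H a).
Proof. exact: (symmetric_of_asymptotic_gap curve_gap). Qed.

Let quotientE t w' : 0 < t -> f (xbar + t *: w') \is a fin_num ->
  second_difference_quotient dot f xbar vbar (t, w') =
  (2 * U t (xbar + t *: w'))%:E.
Proof.
move=> t0 ffin; rewrite /second_difference_quotient /=.
rewrite /U; case: (f _) ffin => // a _; case: (f xbar) fxbar => // b _.
rewrite -!EFinB -EFinM /= (addrC xbar) addrK dotZr; congr (_%:E).
by rewrite invfM invrK exprVn mulrA.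
Qed.

(** Along the curve [xt t y] the subgradient inequality towards [xbar] bounds
    the second-order difference quotients from above. *)
Lemma range_sub_dom w : range H w ->
  dom_second_subderivative dot f xbar vbar w.
Proof.
move=> [y _ <-]; pose C := 2 * (dot (M y) (H y) + r / 2 * `|H y| ^+ 2 + 1).
suff le : (second_subderivative dot f xbar vbar (H y) <= C%:E)%E.
  by rewrite /dom_second_subderivative /= (le_lt_trans le) // ltry.
rewrite /second_subderivative limf_einfE; apply: ge_ereal_sup => _ [V FV <-].
pose w' t := t^-1 *: (xt t y - xbar).
have nV : \forall t \near (0 : R)^'+, V (t, w' t).
  have [[A B] [/= FA FB] ABV] := FV.
  by apply: filterS2 FA (@xt_quotient y B FB) => t At Bt; apply: ABV.
pose phi t := dot (t^-1 *: (vt t y - vbar)) (w' t) + r / 2 * `|w' t| ^+ 2.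
pose L := dot (M y) (H y) + r / 2 * `|H y| ^+ 2.
have cw : w' t @[t --> (0 : R)^'+] --> H y by exact: xt_quotient.
have cv := @vt_quotient y.
have cvgl : phi t @[t --> (0 : R)^'+] --> L.
  apply: cvgD; first by apply: (cvg_dot hdot).
  by apply: cvgMl_tmp; rewrite expr2; under eq_fun do rewrite expr2;
    apply: cvgM; apply: cvg_norm.
have lt1 : \forall t \near (0 : R)^'+, phi t < L + 1.
  by apply: (cvgr_lt _ cvgl); rewrite ltrDl.
have lt2 := near_of_quotient d0 (@xt_quotient y).
have lt4 := near_of_quotient d0 (@vt_quotient y).
have gy := graph_t y.
have [t [Vt t0 dft [xtd vtd ltC]]] : exists t, [/\ V (t, w' t), 0 < t,
    df (xt t y) (vt t y) & [/\ `|xt t y - xbar| < d, `|vt t y - vbar| < d &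
    phi t < L + 1]].
  have /nbhs0_rightP[e e0 /(_ (e / 2))] : \forall t \near (0 : R)^'+,
    [/\ V (t, w' t), 0 < t,
    df (xt t y) (vt t y) & [/\ `|xt t y - xbar| < d, `|vt t y - vbar| < d &
    phi t < L + 1]].
    by near=> t; split; [near: t|near: t; exact: near_pos|near: t|split; near: t].
  move=> h; exists (e / 2); apply: h; first by rewrite divr_gt0.
  by rewrite ltr_pdivrMr // ltr_pMr // ltr1n.
apply: (@le_trans _ _ (second_difference_quotient dot f xbar vbar (t, w' t))).
  by apply: ereal_inf_lbound; exists (t, w' t).
have xE : xbar + t *: w' t = xt t y.
  by rewrite /w' scalerA divff ?gt_eqF // scale1r addrC subrK.
have ffin : f (xt t y) \is a fin_num by case: dft.
rewrite quotientE ?xE // lee_fin /C ler_pM2l //.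
have /= := scaled_ineq t0 dft xtd vtd _ fxbar.
rewrite !subrr scaler0 sub0r normrN normr0 dotNr -/(w' t) => /(_ d0).
have -> : U t xbar = 0 by rewrite /U !subrr dot0r subr0 mulr0.
rewrite /phi /L in ltC; rewrite sub0r; lra.
Unshelve. all: by end_near. Qed.

(** When [H y = 0], the subgradients move at first order in [t] while their base
    points do not. The supporting inequality at these points bounds the
    difference quotients at [w] from below by [a * dot (M y) w] up to a
    constant, for every real [a]. *)
Lemma dom_orth_kernel w y : dom_second_subderivative dot f xbar vbar w ->
  H y = 0 -> dot w (M y) = 0.
Proof.
move=> domw.
have [C CP] : exists C : R, forall V, filter_prod (0 : R)^'+ (nbhs w) V ->
    exists2 p, V p & (second_difference_quotient dot f xbar vbar p < C%:E)%E.
  have [C ltC] : exists C : R,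
      (second_subderivative dot f xbar vbar w < C%:E)%E.
    move: domw; rewrite /dom_second_subderivative /=.
    case: second_subderivative => [c _|//|_].
      by exists (c + 1); rewrite lte_fin ltrDl.
    by exists 0; rewrite ltNyr.
  exists C => V FV; have /ereal_inf_lt[_ [p Vp <-] lt] :
    (ereal_inf (second_difference_quotient dot f xbar vbar @` V) < C%:E)%E.
    apply: le_lt_trans ltC; rewrite /second_subderivative limf_einfE.
    by apply: ereal_sup_ubound; exists V.
  by exists p.
have bound z : H z = 0 -> dot (M z) w <= C / 2 + r / 2 * `|w| ^+ 2.
  move=> Hz.
  rewrite leNgt; apply/negP => ltC.
  pose F := filter_prod (0 : R)^'+ (nbhs w).
  have c1 : p.1 @[p --> F] --> (0 : R)^'+ by exact: cvg_fst.
  have c2 : p.2 @[p --> F] --> w by exact: cvg_snd.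
  have cx : p.1^-1 *: (xt p.1 z - xbar) @[p --> F] --> (0 : X).
    by rewrite -Hz; exact: (cvg_comp _ _ c1 (@xt_quotient z)).
  have cv : p.1^-1 *: (vt p.1 z - vbar) @[p --> F] --> M z.
    exact: (cvg_comp _ _ c1 (@vt_quotient z)).
  pose q (p : R * X) := p.2 - p.1^-1 *: (xt p.1 z - xbar).
  have cq : q p @[p --> F] --> w by rewrite -[w]subr0; exact: cvgB.
  pose phi (p : R * X) := dot (p.1^-1 *: (vt p.1 z - vbar)) (q p) -
    r / 2 * `|q p| ^+ 2 - r / 2 * `|p.1^-1 *: (xt p.1 z - xbar)| ^+ 2.
  have cphi : phi p @[p --> F] -->
      dot (M z) w - r / 2 * `|w| ^+ 2 - r / 2 * `|0 : X| ^+ 2.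
    apply: cvgB; first apply: cvgB; first exact: (cvg_dot hdot).
      by apply: cvgMl_tmp; rewrite expr2; under eq_fun do rewrite expr2;
        apply: cvgM; apply: cvg_norm.
    by apply: cvgMl_tmp; rewrite expr2; under eq_fun do rewrite expr2;
      apply: cvgM; apply: cvg_norm.
  have w1 : 0 < `|w| + 1 by rewrite ltr_wpDl.
  have n1 : F [set p | C / 2 < phi p].
    apply: (cvgr_gt _ cphi); rewrite normr0 expr0n mulr0; lra.
  have n2 : F [set p | `|p.2| < `|w| + 1].
    have cn : `|p.2| @[p --> F] --> `|w| by exact: cvg_norm.
    by apply: (cvgr_lt _ cn); rewrite ltrDl.
  have n3 : F [set p | 0 < p.1 /\ p.1 < d / (`|w| + 1)].
    have : (0 : R)^'+ [set t | 0 < t /\ t < d / (`|w| + 1)].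
      by apply/nbhs0_rightP; exists (d / (`|w| + 1)); first exact: divr_gt0.
    by move=> /c1.
  have n4 : F [set p | df (xt p.1 z) (vt p.1 z)] by exact: (c1 _ (@graph_t z)).
  have n5 : F [set p | `|xt p.1 z - xbar| < d].
    exact: (c1 _ (near_of_quotient d0 (@xt_quotient z))).
  have n6 : F [set p | `|vt p.1 z - vbar| < d].
    exact: (c1 _ (near_of_quotient d0 (@vt_quotient z))).
  have [[t w']] := CP _ (filterI (filterI n1 n2) (filterI (filterI n3 n4)
    (filterI n5 n6))).
  move=> [[/= lt1 lt2] [[[/= t0 lt3] dft] [/= xtd vtd]]].
  have x'd : `|xbar + t *: w' - xbar| < d.
    rewrite (addrC xbar) addrK normrZ gtr0_norm //.
    move: lt3; rewrite ltr_pdivlMr //; apply: le_lt_trans.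
    by rewrite ler_pM2l // ltW.
  have [ffin|] := boolP (f (xbar + t *: w') \is a fin_num); last first.
    rewrite fin_numE negb_and !negbK => /orP[/eqP fy|/eqP fy].
      by have := hf.1 (xbar + t *: w'); rewrite fy ltxx.
    rewrite /second_difference_quotient /= fy.
    case: (f xbar) fxbar => // b _.
    by rewrite gt0_muley ?lte_fin ?invr_gt0 ?mulr_gt0 ?exprn_gt0 //.
  rewrite quotientE // lte_fin => ltC2.
  have /= := scaled_ineq t0 dft xtd vtd x'd ffin.
  have -> : t^-1 *: (xbar + t *: w' - xbar) = w'.
    by rewrite (addrC xbar) addrK scalerA mulVf ?gt_eqF // scale1r.
  have xfin : f (xt t z) \is a fin_num by case: dft.
  have := scaled_ineq t0 dfbar _ _ xtd xfin.
  rewrite /= !subrr normr0 => /(_ d0 d0).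
  have -> : U t xbar = 0 by rewrite /U !subrr dot0r subr0 mulr0.
  rewrite !scaler0 !subr0 dot0l.
  move: lt1; rewrite /phi /q /=; lra.
move=> Hy; rewrite (dotC dot).
set B := C / 2 + r / 2 * `|w| ^+ 2 in bound.
have scale a : a * dot (M y) w <= B.
  have := bound (a *: y); rewrite !linearZ_LR /= Hy scaler0 dotZl.
  exact.
apply/eqP; apply: contraT => dn0.
have := scale ((B + 1) / dot (M y) w).
by rewrite divfK // gerDl ler10.
Qed.

End SecondOrder.

(** * Localizations of the solution mapping and metric regularity *)

Section GeneralizedEquation.
Context (R : realType) (X : normedModType R).
Context (F : X -> set X) (psi L : X -> X) (xbar : X).
Let G x := [set psi x + v | v in F x].
Let vbar := - psi xbar.
Hypotheses (psiL : strict_derivative psi xbar L) (G0 : G xbar 0).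

Let GE x y : G x y <-> F x (y - psi x).
Proof.
split=> [[v Fv <-]|Fy]; first by rewrite addrC addKr.
by exists (y - psi x); rewrite // addrC subrK.
Qed.

Let Fvbar : F xbar vbar.
Proof. by have /GE := G0; rewrite sub0r. Qed.

Section FromLocalization.
Context (s H : X -> X).
Hypotheses (sloc : lipschitz_localization (inverse_map G) 0 xbar s)
  (sH : strict_derivative s 0 H).

Lemma localization_at0 : s 0 = xbar.
Proof.
have [U [V [nU nV SU _]]] := sloc.
have : [set s 0] xbar.
  by rewrite -SU; [split => //; exact: nbhs_singleton | exact: nbhs_singleton].
by move=> ->.
Qed.

Lemma localization_solves : exists2 d : R, 0 < d &
  forall y, `|y| < d -> F (s y) (y - psi (s y)).
Proof.
have [U [V [nU /nbhs_distP[d d0 dV] SU _]]] := sloc.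
exists d => // y yd; apply/GE.
have : (inverse_map G y `&` U) (s y) by rewrite SU //; apply: dV; rewrite subr0.
by case.
Qed.

Lemma localization_unique : exists2 d : R, 0 < d & forall x v, F x v ->
  `|x - xbar| < d -> `|v - vbar| < d -> x = s (v + psi x).
Proof.
have [U [V [/nbhs_distP[d1 d10 d1U] /nbhs_distP[d2 d20 d2V] SU _]]] := sloc.
have d220 : 0 < d2 / 2 by rewrite divr_gt0.
have [d3 d30 d3P] := strict_derivative_continuous psiL d220.
exists (Num.min d1 (Num.min d3 (d2 / 2))); first by rewrite !lt_min d10 d30 d220.
move=> x v Fxv; rewrite !lt_min => /and3P[x1 x2 _] /and3P[_ _ v2].
have : [set s (v + psi x)] x.
  rewrite -SU; last first.
    apply: d2V; rewrite subr0.
    have -> : v + psi x = (v - vbar) + (psi x - psi xbar).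
      by rewrite /vbar opprK addrACA subrr addr0.
    apply: le_lt_trans (ler_normD _ _) _; have := d3P _ x2; lra.
  split; last exact: d1U.
  by apply/GE; rewrite addrK.
by [].
Qed.

Let gph := graph_of F.

(** Near [(xbar, vbar)] the graph is the image of [y |-> (s y, y - psi (s y))],
    with inverse [(x, v) |-> v + psi x]. *)
Lemma section_regular_tangent w v : w = H (v + L w) ->
  regular_tangent_cone gph (xbar, vbar) (w, v).
Proof.
move=> wE.
pose g y := (s y, y - psi (s y)).
have s0 := localization_at0.
have psiL0 : strict_derivative psi (s 0) L by rewrite s0.
have idD : strict_derivative (@id X) 0 id.
  by apply: strict_derivative_lin => // u; exact: cvg_id.
have gD : strict_derivative g 0 (fun y => (H y, y - L (H y))).
  apply: strict_derivative_pair => //; apply: strict_derivativeB => //.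
  exact: strict_derivative_comp psiL0.
have hD : strict_derivative (fun p : X * X => p.2 + psi p.1) (g 0)
    (fun u => u.2 + L u.1).
  apply: strict_derivativeD; first exact: strict_derivative_snd.
  apply: (strict_derivative_comp (strict_derivative_fst _)).
  by rewrite /g /= s0.
have g0 : g 0 = (xbar, vbar) by rewrite /g s0 sub0r.
have [d1 d10 d1P] := localization_solves.
have [d2 d20 d2P] := localization_unique.
rewrite -g0; have -> : (w, v) = (fun y => (H y, y - L (H y))) (v + L w).
  by rewrite -wE addrK.
apply: (@regular_tangent_image _ _ _ setT gph g _ 0 gD
  (fun p => p.2 + psi p.1) (fun u => u.2 + L u.1) (Num.min d1 d2)).
- by rewrite lt_min d10 d20.
- by move=> y _; rewrite subr0 lt_min => /andP[yd _]; exact: d1P.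
- exact: hD.
- by rewrite g0 /vbar /= addNr.
- move=> [x u]; rewrite g0 => Fxu.
  rewrite -[X in `|X|]/(x - xbar, u - vbar) norm_pair_lt !lt_min.
  move=> /andP[/andP[_ xd] /andP[_ ud]]; split => //.
  by rewrite /g /= -d2P // addrK.
- apply/regular_tangentP => e e0; exists 1 => // t y /andP[t0 _] _ _.
  exists (y + t *: (v + L w)) => //.
  by rewrite (addrC y) addrK scalerA mulVf ?gt_eqF // scale1r subrr normr0.
Qed.

(** The map [(x, v) |-> x - s (v + psi x)] vanishes on the graph, so its strict
    derivative vanishes on paratingent vectors. *)
Lemma paratingent_section w v :
  paratingent_cone gph (xbar, vbar) (w, v) -> w = H (v + L w).
Proof.
move=> Twv.
have hD : strict_derivative (fun p : X * X => p.2 + psi p.1) (xbar, vbar)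
    (fun u => u.2 + L u.1).
  apply: strict_derivativeD; first exact: strict_derivative_snd.
  by apply: (strict_derivative_comp (strict_derivative_fst _)).
have kD : strict_derivative (fun p : X * X => p.1 - s (p.2 + psi p.1))
    (xbar, vbar) (fun u => u.1 - H (u.2 + L u.1)).
  apply: strict_derivativeB; first exact: strict_derivative_fst.
  by apply: (strict_derivative_comp hD); rewrite /= /vbar addNr.
have [d d0 dP] := localization_unique.
have /paratingentP T0 : paratingent_cone [set 0]
    (xbar - s (vbar + psi xbar)) (w - H (v + L w)).
  apply: (@paratingent_image _ _ _ gph [set 0] _ _ _ kD d d0 _ (w, v) Twv).
  move=> [x u] Fxu.
  rewrite -[X in `|X|]/(x - xbar, u - vbar) norm_pair_lt => /andP[xd ud].
  by rewrite /= -dP // subrr.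
apply/eqP; rewrite -subr_eq0; apply: contraT; rewrite -normr_gt0 => n0.
have [t [x' [y [_ -> _ -> ]]]] := T0 _ n0.
by rewrite subrr scaler0 sub0r normrN ltxx.
Qed.

Lemma localization_strictly_proto :
  strictly_proto_differentiable F xbar vbar.
Proof.
apply/seteqP; split; first exact: regular_sub_paratingent.
by move=> [w v] /paratingent_section; exact: section_regular_tangent.
Qed.

(** Values [u] of [G x] close to [0] satisfy [x = s u], and the Lipschitz
    bound applies. For the other values the residual is bounded below, while
    [`|x - s y|] is small. *)
Lemma localization_metrically_regular : metrically_regular G xbar 0.
Proof.
have s0 := localization_at0.
have [U [V [/nbhs_distP[d1 d10 d1U] /nbhs_distP[d2 d20 d2V] SU [k lip]]]] := sloc.
pose a := Num.min d1 (d2 / 2).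
have a0 : 0 < a by rewrite lt_min d10 divr_gt0.
have lipV y y' : `|y| < d2 -> `|y'| < d2 -> `|s y - s y'| <= `|k| * `|y - y'|.
  move=> yd y'd; apply: (@le_trans _ _ (k * `|y - y'|)).
    by apply: (lip (y, y')); split; apply: d2V; rewrite subr0.
  by rewrite ler_wpM2r // ler_norm.
pose kappa := `|k| + 1.
have kappa0 : 0 < kappa by rewrite ltr_wpDl.
exists kappa, [set x | `|x - xbar| < a], [set y | `|y| < a]; split => //.
- by apply/nbhs_distP; exists a.
- by apply/nbhs_distP; exists a => // y; rewrite subr0.
move=> x y /= xa ya.
have a1 : a <= d1 by rewrite ge_min lexx.
have a2 : a <= d2 / 2 by rewrite ge_min lexx orbT.
have yd : `|y| < d2 by lra.
have d20' : `|0 : X| < d2 by rewrite normr0.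
have le1 : (dist_to x (inverse_map G y) <= `|x - s y|%:E)%E.
  apply: ereal_inf_lbound; exists (s y) => //.
  have : (inverse_map G y `&` U) (s y) by rewrite SU //; apply: d2V; rewrite subr0.
  by case.
rewrite muleC -lee_pdivrMr //; apply: le_ereal_inf_tmp => _ [u Gxu <-].
rewrite lee_pdivrMr // -EFinM; apply: le_trans le1 _; rewrite lee_fin mulrC.
have := normr_ge0 k; have := normr_ge0 (y - u) => yu0 k0.
have [yu|yu] := ltP `|y - u| (d2 / 2).
  have ud : `|u| < d2.
    have -> : u = y - (y - u) by rewrite opprB addrC subrK.
    apply: le_lt_trans (ler_normB _ _) _; lra.
  have -> : x = s u.
    have : [set s u] x.
      rewrite -SU; last by apply: d2V; rewrite subr0.
      by split => //; apply: d1U; exact: lt_le_trans xa a1.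
    by [].
  have := lipV _ _ ud yd; rewrite (distrC u) /kappa; lra.
have -> : x - s y = (x - xbar) + (s 0 - s y) by rewrite s0 addrA subrK.
apply: le_trans (ler_normD _ _) _.
have := lipV _ _ d20' yd; rewrite sub0r normrN => le2.
have : `|k| * `|y| <= `|k| * (d2 / 2) by apply: ler_wpM2l; lra.
have : `|k| * (d2 / 2) <= `|k| * `|y - u| by apply: ler_wpM2l.
rewrite /kappa; lra.
Qed.

End FromLocalization.

Section FromMetricRegularity.
Context (dot : {dot X for (@idfun R)}).
Hypotheses (hfin : finite_dimensional X) (hdot : induces_norm dot)
  (Gmr : metrically_regular G xbar 0).

Lemma metric_regularity_solutions : exists2 k : R, 0 < k & exists2 d : R, 0 < d &
  forall y (e : R), `|y| < d -> 0 < e ->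
    exists2 x, G x y & `|x - xbar| < k * `|y| + e.
Proof.
have [k [U [V [k0 nU nV mr]]]] := Gmr.
have Ux := nbhs_singleton nU.
move: nV => /nbhs_distP[d d0 dV].
exists k => //; exists d => // y e yd e0.
have le1 : (dist_to xbar (inverse_map G y) < (k * `|y| + e)%:E)%E.
  apply: le_lt_trans (mr xbar y Ux (dV y _)) _; first by rewrite subr0.
  apply: (@le_lt_trans _ _ (k%:E * `|y|%:E)%E).
    rewrite lee_pmul2l //; apply: ereal_inf_lbound.
    by exists 0 => //; rewrite subr0.
  by rewrite -EFinM lte_fin ltrDl.
have /ereal_inf_lt[_ [x Gxy <-]] := le1.
by rewrite lte_fin distrC => lt1; exists x.
Qed.

(** As [0] lies in [G xbar], the residual of [t *: y] at [xbar] is of order [t],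
    and [t *: y] lies in [G x] for some [x] at distance of order [t] from [xbar];
    a cluster point of these difference quotients is the wanted [w]. *)
Lemma metric_regularity_tangent y : exists w,
  tangent_cone (graph_of G) (xbar, 0) (w, y).
Proof.
have [k k0 [d d0 dP]] := metric_regularity_solutions.
apply: contrapT => nT.
pose c := k * `|y| + 1.
pose P (t : R) (w : X) := forall x, G x (t *: y) -> t^-1 *: (x - xbar) <> w.
have : \forall t \near (0 : R)^'+, [set w : X | `|w| <= c] `<=` P t.
  have cB : compact [set w : X | `|w| <= c].
    exact: (compact_closed_ball0 hfin hdot).
  have /compact_near_coveringP/(_ R (0 : R)^'+ P _) := cB.
  apply => w _.
  have [e e0 eP] : exists2 e : R, 0 < e & forall t q, 0 < t < e ->
      graph_of G q -> ~ `|t^-1 *: (q - (xbar, 0)) - (w, y)| < e.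
    apply: contrapT => ne; apply: nT; exists w; apply/tangentP => e e0.
    apply: contrapT => nq; apply: ne; exists e => // t q te Gq lt1.
    by apply: nq; exists t, q.
  exists ([set w' | `|w' - w| < e], [set t | 0 < t < e]).
    split; first by apply/nbhs_distP; exists e.
    by apply/nbhs0_rightP; exists e => // t t0 te; apply/andP.
  move=> [w' t] [/= we te] x Gx xw; apply: (eP t (x, t *: y) te Gx).
  have /andP[t0 _] := te.
  have -> : t^-1 *: ((x, t *: y) - (xbar, 0)) - (w, y) =
      (t^-1 *: (x - xbar) - w, t^-1 *: (t *: y - 0) - y) by [].
  rewrite norm_pair_lt xw we subr0 scalerA mulVf ?gt_eqF // scale1r subrr normr0.
  by rewrite (lt_trans t0) //; case/andP: te.
move=> /nbhs0_rightP[e e0 eP].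
have y1 : 0 < `|y| + 1 by rewrite ltr_wpDl.
pose t := Num.min (e / 2) (d / (2 * (`|y| + 1))).
have t0 : 0 < t by rewrite lt_min !divr_gt0 // mulr_gt0.
have te : t < e by rewrite gt_min ltr_pdivrMr // ltr_pMr // ltr1n.
have td : `|t *: y| < d.
  rewrite normrZ gtr0_norm //; apply: (@le_lt_trans _ _ (d / (2 * (`|y| + 1)) * `|y|)).
    by apply: ler_wpM2r; rewrite // ge_min lexx orbT.
  rewrite -mulrA gtr_pMr // mulrC ltr_pdivrMr ?mulr_gt0 //.
  have := normr_ge0 y; lra.
have [x Gx xd] := dP _ _ td t0.
apply: (eP t t0 te (t^-1 *: (x - xbar)) _ x Gx) => //=.
rewrite normrZ gtr0_norm ?invr_gt0 // mulrC ler_pdivrMr //.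
move: xd; rewrite normrZ gtr0_norm // /c; lra.
Qed.

Lemma compact_pair_sphere : compact [set u : X * X | `|u| = 1].
Proof.
have cB : compact [set w : X | `|w| <= 1].
  exact: (compact_closed_ball0 hfin hdot).
apply: (subclosed_compact _ (compact_setX cB cB)).
  apply: (@preimage_closed _ _ (fun u : X * X => `|u|) [set r | r = 1]).
    by move=> u _; exact: norm_continuous.
  exact: closed_eq.
by move=> [x y] /= u1; have : `|(x, y)| <= 1 by [rewrite u1];
  rewrite norm_pair => /andP[].
Qed.

Hypotheses (Fproto : strictly_proto_differentiable F xbar vbar) (r : R)
  (Fmono : forall w v, paratingent_cone (graph_of F) (xbar, vbar) (w, v) ->
     - r * `|w| ^+ 2 <= dot v w).

(** Metric regularity makes [v + L w] surjective on the tangent space, and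
    hypomonotonicity bounds the dimension of that space by that of [X]: it is
    the graph of a linear [H] over the values of [v + L w]. The pairs [(x, y)]
    with [G x y] then have paratingent vectors of the form [(H y, y)] only, so
    [x' - x] is [H (y' - y)] up to a small multiple of the larger increment.
    This gives uniqueness, the Lipschitz bound and the strict derivative. *)
Lemma metric_regularity_localization : exists (H : {linear X -> X}) (s : X -> X),
  lipschitz_localization (inverse_map G) 0 xbar s /\ strict_derivative s 0 H.
Proof.
have [lL cL _] := psiL.
have [L' LE] := exists_linear lL.
pose W := paratingent_cone (graph_of F) (xbar, vbar).
have Gbar : graph_of G (xbar, 0) by exact: G0.
(* Adding a multiple of [psi] to a mapping shears its paratingent cone. *)
have shear (Omega Omega' : set (X * X)) (p : X * X) (a : R) : p.1 = xbar ->
    (forall q, Omega q -> Omega' (q.1, q.2 + a *: psi q.1)) ->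
    forall u, paratingent_cone Omega p u ->
      paratingent_cone Omega' (p.1, p.2 + a *: psi p.1) (u.1, u.2 + a *: L u.1).
  move=> p1 OO'; apply: (@paratingent_image _ _ _ Omega Omega'
    (fun q => (q.1, q.2 + a *: psi q.1)) (fun u => (u.1, u.2 + a *: L u.1))
    p _ 1 ltr01); last by move=> q Oq _; exact: OO'.
  apply: strict_derivative_pair; first exact: strict_derivative_fst.
  apply: strict_derivativeD; first exact: strict_derivative_snd.
  have la : linear ( *:%R a : X -> X).
    by move=> b u v; rewrite scalerDr !scalerA mulrC.
  have ca : continuous ( *:%R a : X -> X) by move=> u; exact: scaler_continuous.
  have aD : strict_derivative (fun x => a *: psi x) p.1 (fun u => a *: L u).
    rewrite p1.
    exact: (strict_derivative_comp psiL (strict_derivative_lin (psi xbar) la ca)).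
  exact: (strict_derivative_comp (strict_derivative_fst p) aD).
have GF w y : paratingent_cone (graph_of G) (xbar, 0) (w, y) -> W (w, y - L w).
  move=> /(@shear _ (graph_of F) (xbar, 0) (-1) erefl) h.
  move: h => /=; rewrite !scaleN1r sub0r; apply.
  by move=> [x z] /GE; rewrite /= scaleN1r.
have [|w v Wwv|y|H HP] := @graph_of_hypomonotone_subspace R X dot hfin hdot W L' r.
- exact: subspace_paratingent Fvbar Fproto.
- exact: Fmono.
- have [w Tw] := metric_regularity_tangent y; exists w; rewrite -LE.
  by apply/GF/(tangent_sub_paratingent Gbar).
have GH w y : paratingent_cone (graph_of G) (xbar, 0) (w, y) -> w = H y.
  by move=> /GF/HP; rewrite -LE subrK.
have cH : continuous H by exact: (finite_dim_linear_continuous hfin hdot).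
have [|l lE] := @exists_linear R _ X (fun u : X * X => u.1 - H u.2).
  by move=> a [u u'] [v v'] /=; rewrite linearP scalerBr opprD addrACA.
have lc : continuous l.
  rewrite -lE => u; apply: cvgB; first exact: cvg_fst.
  by apply: (@continuous_comp _ _ _ snd H); [exact: cvg_snd | exact: cH].
have lT u : paratingent_cone (graph_of G) (xbar, 0) u -> l u = 0.
  by case: u => w y /GH wE; rewrite -lE /= -wE subrr.
have approx := strict_approximation compact_pair_sphere lc lT.
have [M M0 HM] := linear_bound (linearP H) cH.
have approxG (e : R) : 0 < e -> exists2 d : R, 0 < d & forall x y x' y',
    G x y -> G x' y' -> `|x - xbar| < d -> `|y| < d -> `|x' - xbar| < d ->
    `|y'| < d -> `|x' - x - H (y' - y)| <= e * Num.max `|x' - x| `|y' - y|.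
  move=> e0; have [d d0 dP] := approx e e0; exists d => // x y x' y' Gxy Gxy'.
  move=> xd yd x'd y'd; have := dP (x, y) (x', y') Gxy Gxy'.
  rewrite -[X in `|X| < _ -> _]/(x - xbar, y - 0) norm_pair_lt xd subr0 yd.
  rewrite -[X in _ -> `|X| < _ -> _]/(x' - xbar, y' - 0) norm_pair_lt x'd subr0 y'd.
  by rewrite -lE /= prod_normE /= => /(_ isT isT).
pose c := 2 * M + 1.
have c1 : 1 <= c by rewrite /c; lra.
have c0 : 0 < c by lra.
have half0 : 0 < 2^-1 :> R by rewrite invr_gt0.
have [d1 d10 d1P] := approxG _ half0.
have lip x y x' y' : G x y -> G x' y' -> `|x - xbar| < d1 -> `|y| < d1 ->
    `|x' - xbar| < d1 -> `|y'| < d1 -> `|x' - x| <= c * `|y' - y|.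
  move=> Gxy Gxy' xd yd x'd y'd.
  have le1 := d1P _ _ _ _ Gxy Gxy' xd yd x'd y'd.
  have le2 : Num.max `|x' - x| `|y' - y| <= `|x' - x| + `|y' - y|.
    by rewrite ge_max lerDl lerDr !normr_ge0.
  have le3 := HM (y' - y).
  have : `|x' - x| <= `|x' - x - H (y' - y)| + `|H (y' - y)|.
    by rewrite -{1}(subrK (H (y' - y)) (x' - x)) ler_normD.
  rewrite /c; lra.
have [k k0 [d d0 dP]] := metric_regularity_solutions.
pose b := Num.min d (Num.min d1 (d1 / (2 * k))).
have b0 : 0 < b by rewrite !lt_min d0 d10 divr_gt0 // mulr_gt0.
have /choice[s sP] : forall y, exists x, `|y| < b -> G x y /\ `|x - xbar| < d1.
  move=> y; have [yb|yb] := ltP `|y| b; last by exists 0.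
  move: yb; rewrite !lt_min => /and3P[yd _ yk].
  have [|x Gxy xd] := dP y (d1 / 2) yd; first by rewrite divr_gt0.
  exists x => _; split => //; apply: lt_trans xd _.
  move: yk; rewrite ltr_pdivlMr ?mulr_gt0 // => yk; lra.
have bd1 (y : X) : `|y| < b -> `|y| < d1 by rewrite !lt_min => /and3P[].
have sE y x : `|y| < b -> G x y -> `|x - xbar| < d1 -> x = s y.
  move=> yb Gxy xd; have [Gsy syd] := sP y yb.
  have := lip _ _ _ _ Gsy Gxy syd (bd1 _ yb) xd (bd1 _ yb).
  rewrite subrr normr0 mulr0 normr_le0 subr_eq0 => /eqP.
  by [].
have slip y y' : `|y| < b -> `|y'| < b -> `|s y' - s y| <= c * `|y' - y|.
  move=> yb y'b; have [Gsy syd] := sP y yb; have [Gsy' syd'] := sP y' y'b.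
  exact: lip (Gsy) (Gsy') syd (bd1 _ yb) syd' (bd1 _ y'b).
exists H, s; split.
  exists [set x | `|x - xbar| < d1], [set y | `|y| < b]; split.
  - by apply/nbhs_distP; exists d1.
  - by apply/nbhs_distP; exists b => // y; rewrite subr0.
  - move=> y yb; apply/seteqP; split=> [x [Gxy xd]|_ ->].
      exact: sE.
    by have [Gsy syd] := sP y yb.
  - by exists c => -[y y'] [yb y'b]; apply: slip.
split; [exact: linearP | exact: cH | move=> e e0].
have s0 : s 0 = xbar.
  by apply/esym/sE; rewrite ?normr0 ?subrr ?normr0.
have ec0 : 0 < e / c by rewrite divr_gt0.
have [d2 d20 d2P] := approxG _ ec0.
pose m := Num.min b (Num.min d2 (d2 / c)).
exists m; first by rewrite lt_min b0 lt_min d20 divr_gt0.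
have near y : `|y - 0| < m -> [/\ `|y| < b, `|y| < d2 & `|s y - xbar| < d2].
  rewrite subr0 lt_min => /andP[yb]; rewrite lt_min => /andP[y2 yc].
  split => //.
  rewrite -s0; apply: le_lt_trans (slip 0 y _ yb) _; first by rewrite normr0.
  by rewrite subr0 mulrC -ltr_pdivlMr.
move=> y y' /near[yb yd syd] /near[y'b y'd syd'].
have [Gsy _] := sP y yb; have [Gsy' _] := sP y' y'b.
apply: le_trans (d2P _ _ _ _ Gsy Gsy' syd yd syd' y'd) _.
rewrite -mulrA ler_pM2l // mulrC ler_pdivrMr // mulrC ge_max slip //=.
by rewrite ler_peMl.
Qed.

End FromMetricRegularity.

End GeneralizedEquation.

(** * Normal cones of subspaces, and the equivalence *)

Section NormalConeOfSubspace.
Context (R : realType) (X : normedModType R) (dot : {dot X for (@idfun R)}).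
Hypotheses (hdot : induces_norm dot).
Context (K : set X) (sK : linear_subspace K).

Lemma closed_dot_eq0 u : closed [set v | dot v u = 0].
Proof.
apply: (@preimage_closed _ _ (fun v : X => dot v u) [set r | r = 0]).
  by move=> v _; apply: (cvg_dot hdot); [exact: cvg_id | exact: cvg_cst].
exact: closed_eq.
Qed.

Lemma subspace_tangent x : K x -> K `<=` tangent_cone K x.
Proof.
move=> Kx q Kq; apply/tangentP => e e0; exists (e / 2), (x + (e / 2) *: q).
have e20 : 0 < e / 2 by rewrite divr_gt0.
rewrite e20 ltr_pdivrMr // ltr_pMr // ltr1n; split => //.
  by apply: subspaceD => //; exact: subspaceZ.
by rewrite (addrC x) addrK scalerA mulVf ?gt_eqF // scale1r subrr normr0.
Qed.

Lemma regular_normal_subspace x v :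
  regular_normal_cone dot K x v <-> K x /\ orth_compl dot K v.
Proof.
split=> [[Kx pv]|[Kx ov]]; split => //.
  move=> q Kq; apply/eqP; rewrite eq_le pv /=; last exact: (subspace_tangent Kx).
  rewrite -oppr_le0 -dotNr; apply: pv; apply: subspace_tangent => //.
  by rewrite -scaleN1r; exact: subspaceZ.
move=> u /(tangent_sub_paratingent Kx).
move=> Tu; suff : dot u v = 0 by rewrite (dotC dot) => ->.
apply: (paratingent_sub_closed ltr01 (@closed_dot_eq0 v) _ Tu).
move=> t p q _ Kp Kq _ _ /=; rewrite (dotC dot); apply: ov.
by apply: subspaceZ => //; exact: subspaceB.
Qed.

Lemma limiting_normal_subspace x v :
  limiting_normal_cone dot K x v <-> K x /\ orth_compl dot K v.
Proof.
split=> [[Kx [xk [vk [_ vN _ vc]]]]|[Kx ov]]; split => //.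
  move=> q Kq; have := @closed_cvg _ _ _ _ vk _ (@closed_dot_eq0 q) _ _ vc.
  apply; apply: nearW => k.
  by have /regular_normal_subspace[_] := vN k; apply.
exists (fun=> x), (fun=> v); split => //; [|exact: cvg_cst|exact: cvg_cst].
by move=> _; apply/regular_normal_subspace.
Qed.

End NormalConeOfSubspace.

Section Hypomonotone.
Context (R : realType) (X : normedModType R) (dot : {dot X for (@idfun R)}).
Hypotheses (hdot : induces_norm dot).
Context (f : X -> \bar R) (xbar vbar : X) (d r : R).

(** Adding the subgradient inequalities between two points of the graph cancels
    the values of [f]. *)
Lemma paratingent_hypomonotone : 0 < d ->
  uniform_subgradient_inequality dot f xbar vbar d r ->
  forall w v, paratingent_cone (graph_of (subdifferential dot f)) (xbar, vbar)
    (w, v) -> - r * `|w| ^+ 2 <= dot v w.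
Proof.
move=> d0 ineq w v Twv.
pose C := [set p : X * X | 0 <= dot p.2 p.1 + r * `|p.1| ^+ 2].
suff : C (w, v) by rewrite /C /=; lra.
apply: (@paratingent_sub_closed _ _ _ _ C d d0 _ _ (w, v) Twv).
  apply: (@preimage_closed _ _ (fun p : X * X => dot p.2 p.1 + r * `|p.1| ^+ 2)
    [set a | 0 <= a]); last exact: closed_ge.
  move=> p _; have c1 : q.1 @[q --> p] --> p.1 by exact: cvg_fst.
  have c2 : q.2 @[q --> p] --> p.2 by exact: cvg_snd.
  apply: cvgD; first exact: (cvg_dot hdot).
  by apply: cvgMl_tmp; rewrite expr2; under eq_fun do rewrite expr2;
    apply: cvgM; apply: cvg_norm.
move=> t [x u] [x' u'] t0 dfx dfx'.
rewrite -[X in `|X| < _ -> _]/(x - xbar, u - vbar) norm_pair_lt => /andP[xd ud].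
rewrite -[X in `|X| < _ -> _]/(x' - xbar, u' - vbar) norm_pair_lt => /andP[x'd u'd].
have fx : f x \is a fin_num by case: dfx.
have fx' : f x' \is a fin_num by case: dfx'.
have := fine_ineq ineq dfx xd ud x'd fx'.
have := fine_ineq ineq dfx' x'd u'd xd fx.
rewrite /C /= normrZ gtr0_norm ?invr_gt0 // dotZl dotZr exprMn.
move=> le1 le2.
have -> : t^-1 * (t^-1 * dot (u' - u) (x' - x)) + r * (t^-1 ^+ 2 * `|x' - x| ^+ 2)
  = t^-1 ^+ 2 * (dot (u' - u) (x' - x) + r * `|x' - x| ^+ 2) by ring.
apply: mulr_ge0; first by rewrite sqr_ge0.
move: le1 le2; rewrite (distrC x x') dotBl !dotBr; lra.
Qed.

End Hypomonotone.

Theorem theorem4p2 (R : realType) (X : normedModType R)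
    (dot : {dot X for (@idfun R)}) (psi : X -> X) (f : X -> \bar R) (xbar : X)
    (hfin : finite_dimensional X) (hdot : induces_norm dot)
    (hpsi : forall x, differentiable psi x) (hf : proper_fun f) :
  let df := subdifferential dot f in
  let G := fun x => [set psi x + v | v in df x] in
  let S := inverse_map G in
  let vbar := - psi xbar in
  G xbar 0 ->
  strictly_differentiable psi xbar ->
  prox_regular dot f xbar vbar ->
  subdifferentially_continuous dot f xbar vbar ->
  let a := metrically_regular G xbar 0 /\
           strictly_proto_differentiable df xbar vbar in
  let is_s := fun s : X -> X =>
    lipschitz_localization S 0 xbar s /\ strictly_differentiable s 0 in
  let K := dom_second_subderivative dot f xbar vbar in
  let is_A := fun A : {linear X -> X} =>
    symmetric_map dot A /\ graphical_derivative_form dot f xbar vbar K A in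
  (a <-> exists s, is_s s) /\
  (a ->
    [/\ linear_subspace K,
        exists A, is_A A &
        forall (A : {linear X -> X}) (s : X -> X), is_A A -> is_s s ->
          let B := fun w => projection K ('d psi xbar w + A w) in
          set_bij K K B /\
          'd s 0 = 'pinv_(fun=> 0) K B \o projection K :> (X -> X)]).
Proof.
move=> df G S vbar G0 /strictly_differentiableP[_ psiL] prox sc a is_s K is_A.
have [d [r [d0 ineq]]] := prox_regular_uniform prox sc.
have [fxbar _ dfbar _] := prox.
have mono := paratingent_hypomonotone hdot d0 ineq.
have sloc s : is_s s -> lipschitz_localization S 0 xbar s /\
    strict_derivative s 0 ('d s 0).
  by move=> [ls /strictly_differentiableP[_ ds]].
have a_loc : a -> exists (H : {linear X -> X}) s,
    lipschitz_localization S 0 xbar s /\ strict_derivative s 0 H.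
  move=> [mr sp].
  exact: (metric_regularity_localization psiL G0 hfin hdot mr sp mono).
split.
  split=> [/a_loc[H [s [ls sH]]]|[s /sloc[ls sH]]].
    by exists s; split => //; have [] := strict_derivative_diff sH.
  split; first exact: (localization_metrically_regular G0 ls).
  exact: (localization_strictly_proto psiL G0 ls sH).
move=> /a_loc[H [s [ls sH]]].
set L := 'd psi xbar in psiL *.
have tangentE w v : tangent_cone (graph_of df) (xbar, vbar) (w, v) <->
    w = H (v + L w).
  split=> [T|wE].
    apply: (paratingent_section psiL ls sH).
    exact: tangent_sub_paratingent T.
  apply: regular_sub_tangent => //.
  exact: (section_regular_tangent psiL G0 ls sH).
have [M ME] : exists M : {linear X -> X}, (fun y => y - L (H y)) = M.
  by apply: exists_linear => b x y;
    rewrite (linearP H) (linearP L) scalerBr opprD addrACA.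
pose xt (t : R) y := s (t *: y).
pose vt (t : R) y := t *: y - psi (s (t *: y)).
have s0 := localization_at0 G0 ls.
have psiL0 : strict_derivative psi (s 0) L by rewrite s0.
have graph_t y : \forall t \near (0 : R)^'+, df (xt t y) (vt t y).
  have [d' d'0 d'P] := localization_solves ls.
  have y1 : 0 < `|y| + 1 by rewrite ltr_wpDl.
  apply/nbhs0_rightP; exists (d' / (`|y| + 1)); first exact: divr_gt0.
  move=> t t0; rewrite ltr_pdivlMr // => td; apply: d'P.
  rewrite normrZ gtr0_norm //; apply: le_lt_trans td.
  by rewrite ler_pM2l // lerDl.
have xq y : t^-1 *: (xt t y - xbar) @[t --> (0 : R)^'+] --> H y.
  have := @strict_derivative_ray _ _ _ _ _ _ y sH; rewrite s0.
  by under eq_fun do rewrite add0r.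
have vq y : t^-1 *: (vt t y - vbar) @[t --> (0 : R)^'+] --> M y.
  have idD : strict_derivative (@id X) 0 id.
    by apply: strict_derivative_lin => // u; exact: cvg_id.
  have vD : strict_derivative (fun y => y - psi (s y)) 0 M.
    rewrite -ME; apply: strict_derivativeB => //.
    exact: (strict_derivative_comp sH psiL0).
  have := @strict_derivative_ray _ _ _ _ _ _ y vD; rewrite s0 sub0r.
  by under eq_fun do rewrite add0r.
have symMH b c : dot (M b) (H c) = dot (M c) (H b).
  exact: (curves_lagrangian hdot d0 ineq graph_t xq vq).
have monoMH y : - r * `|H y| ^+ 2 <= dot (M y) (H y).
  apply: mono; apply: tangent_sub_paratingent => //.
  by apply/tangentE; rewrite -ME subrK.
have [||Q [symQ rangeQ kerQ QP]] :=
  @lagrangian_coordinates R X dot hfin hdot H L (r + 1).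
- by move=> b c; have := symMH b c; rewrite -ME.
- move=> y; rewrite -[y - L (H y)]/((fun y => y - L (H y)) y) ME => My0.
  have MyE : M y = - (r + 1) *: H y.
    by rewrite scaleNr; apply/eqP; rewrite -addr_eq0 My0.
  have Hy0 : H y = 0.
    apply: (dot_eq0 hdot); rewrite -hdot; apply/eqP; rewrite eq_le sqr_ge0 andbT.
    by have := monoMH y; rewrite MyE dotZl -hdot; lra.
  by move: MyE; rewrite -ME /= Hy0 linear0 subr0 scaler0.
have KE : K = range Q.
  rewrite rangeQ; apply/seteqP; split=> w.
    move=> Kw; rewrite -rangeQ; apply: (symmetric_range hfin hdot symQ) => z.
    move=> /kerQ[y Hy ->].
    rewrite -[y - L (H y)]/((fun y => y - L (H y)) y) ME.
    exact: (dom_orth_kernel hdot d0 hf fxbar dfbar ineq graph_t xq vq Kw Hy).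
  exact: (range_sub_dom hdot d0 fxbar ineq graph_t xq vq).
have sK : linear_subspace K by rewrite KE; exact: range_subspace.
have [A0 [symA0 A0P]] := symmetric_part_exists hfin hdot (r + 1) symQ.
have formE (A : {linear X -> X}) : graphical_derivative_form dot f xbar vbar K A <->
    forall w v, w = H (v + L w) <-> K w /\ orth_compl dot K (v - A w).
  have imE w v : [set A w + z | z in limiting_normal_cone dot K w] v <->
      K w /\ orth_compl dot K (v - A w).
    split=> [[z /(limiting_normal_subspace hdot sK) Kz <-]|Kz].
      by rewrite addrC addKr.
    exists (v - A w); first exact/(limiting_normal_subspace hdot sK).
    by rewrite addrC subrK.
  split=> [form w v|AP w]; first by rewrite -tangentE -imE -form.
  by apply/seteqP; split=> v; [move=> /tangentE/AP/imE | move=> /imE/AP/tangentE].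
split => //.
  exists A0; split => //; apply/formE => w v.
  by rewrite KE -A0P -QP.
move=> A s' [symA /formE AP] /sloc[ls' ds'] B.
have Porth := projection_orth hfin hdot sK.
have projO z : orth_compl dot K z -> projection K z = 0.
  move=> Oz; apply: (projection_eq hdot) => //; first exact: subspace0.
  by move=> q Kq; rewrite subr0; exact: Oz.
have Plin := projection_linear hfin hdot sK.
have PlinB u v : projection K (u - v) = projection K u - projection K v.
  exact: linearfB.
have projE w v : w = H (v + L w) -> K w /\ projection K (v + L w) = B w.
  move=> /AP[Kw Ov]; split => //.
  apply/eqP; rewrite /B -subr_eq0 -PlinB; apply/eqP/projO.
  by rewrite addrKA.
have Binj : {in K &, injective B}.
  move=> w1 w2; rewrite !inE => K1 K2 B12.
  have : w1 - w2 = H (- L (w1 - w2) + L (w1 - w2)).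
    apply/AP; split; first exact: subspaceB.
    have [_ O] := Porth (L (w1 - w2) + A (w1 - w2)).
    have P0 : projection K (L (w1 - w2) + A (w1 - w2)) = 0.
      have -> : L (w1 - w2) + A (w1 - w2) = (L w1 + A w1) - (L w2 + A w2).
        by rewrite (linearB L) (linearB A) addrACA -opprD.
      by rewrite PlinB -[projection K (L w1 + _)]/(B w1) B12 subrr.
    move: O; rewrite P0 subr0 => O q Kq.
    by rewrite -opprD dotNl O // oppr0.
  rewrite addNr linear0 => /eqP; rewrite subr_eq0 => /eqP.
  by [].
have BK : set_bij K K B.
  split => //; first by move=> w _; have [] := Porth ('d psi xbar w + A w).
  move=> u Ku; have [KH uE] : K (H u) /\ projection K (u - L (H u) + L (H u)) = B (H u).
    by apply: projE; rewrite subrK.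
  exists (H u) => //; rewrite -uE subrK.
  by apply: (projection_eq hdot) => // q _; rewrite subrr dot0l.
split => //.
apply/funext => y /=.
have Ty : tangent_cone (graph_of df) (xbar, vbar) ('d s' 0 y, y - L ('d s' 0 y)).
  apply: regular_sub_tangent => //.
  by apply: (section_regular_tangent psiL G0 ls' ds'); rewrite subrK.
have [Kw yE] : K ('d s' 0 y) /\
    projection K (y - L ('d s' 0 y) + L ('d s' 0 y)) = B ('d s' 0 y).
  by apply: projE; apply/tangentE.
by rewrite -[in RHS](subrK (L ('d s' 0 y)) y) yE pinvKV // inE.
Qed.
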